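(* Let $(A,\Sigma)$ be an irreducible Artin--Tits system of spherical type such that $A\neq A_1, A_2, I_{2m}$. Consider the action of $A$ by left multiplication on its additional length graph $\mathcal{C}_{AL}(A)$. Then every periodic element of $A$, and every element of $A$ preserving some simplex of the complex of irreducible parabolic subgroups $\mathcal{P}(A)$ (i.e. normalizing some nontrivial proper parabolic subgroup of $A$), acts elliptically on $\mathcal{C}_{AL}(A)$.
   Context: Artin--Tits groups. Given a finite set $\Sigma$ and a symmetric matrix $(m_{s,t})_{s,t\in\Sigma}$ with $m_{s,s}=1$ and $m_{s,t}\in\{2,3,\dots,\infty\}$ for $s\ne t$, the Artin--Tits group is $A=\langle \Sigma \mid sts\cdots=tst\cdots \ (m_{s,t}\text{ letters on each side}),\ s\neq t,\ m_{s,t}\neq\infty\rangle$; $(A,\Sigma)$ is an Artin--Tits system. It is of spherical type if the Coxeter group obtained by adding the relations $s^2=1$ ($s\in\Sigma$) is finite, and irreducible if $A$ is not a direct product of nontrivial Artin--Tits groups (equivalently the Coxeter graph is connected). $A_1$ and $A_2$ are the Artin--Tits groups of Coxeter types $A_1$, $A_2$, and $I_{2m}$ is the one with two generators $s,t$ and $m_{s,t}=m$, $3\le m<\infty$ (so the condition means $|\Sigma|\geq 3$). Garside structure. Let $A^+$ be the submonoid of $A$ generated by $\Sigma$. Write $a\preccurlyeq b$ iff $a^{-1}b\in A^+$; in spherical type this is a lattice order on $A$. The Garside element is $\Delta=\bigvee_{s\in\Sigma}s$ (least common multiple for $\preccurlyeq$). Simple elements are those $s$ with $1\preccurlyeq s\preccurlyeq\Delta$.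 Put $\inf(x)=\max\{p\in\mathbb{Z} : \Delta^p\preccurlyeq x\}$ and $\sup(x)=\min\{p\in\mathbb{Z} : x\preccurlyeq\Delta^p\}$. Absorbable elements. $y\in A$ is absorbable if ($\inf(y)=0$ or $\sup(y)=0$) and there is $x\in A$ with $\inf(xy)=\inf(x)$ and $\sup(xy)=\sup(x)$. Additional length graph $\mathcal{C}_{AL}(A)$. Vertices are the cosets $g\Delta^{\mathbb{Z}}=\{g\Delta^p : p\in\mathbb{Z}\}$, $g\in A$; each vertex $v$ has a unique representative $\overline v$ with $\inf(\overline v)=0$. Two vertices $v,w$ are joined by an edge iff either there is a simple element $m\neq 1,\Delta$ with $\overline v m\in w$, or there is an absorbable $y\in A$ with $\overline v y\in w$. Edges have length 1. $A$ acts on it by isometries by left multiplication. An element acts elliptically if its orbits (the orbits of the cyclic group it generates) are bounded. Parabolic subgroups. For $X\subseteq\Sigma$, $A_X=\langle X\rangle$ is a standard parabolic subgroup; a parabolic subgroup is a conjugate $P=\alpha^{-1}A_X\alpha$, $\alpha\in A$. It is irreducible if it is not a direct product of nontrivial parabolic subgroups. For irreducible $P=\alpha^{-1}A_X\alpha\neq 1$, let $z_P=\alpha^{-1}z_X\alpha$, where $z_X$ is the generator of the (infinite cyclic) center of $A_X$ that lies in $A^+$ (this is well defined). $\mathcal{P}(A)$ is the simplicial complex whose vertices are the nontrivial proper irreducible parabolic subgroups, where $\{P_0,\dots,P_n\}$ spans a simplex iff $z_{P_i}z_{P_j}=z_{P_j}z_{P_i}$ for all $i\neq j$. $A$ acts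 on $\mathcal{P}(A)$ by conjugation. An element $x\in A$ is periodic if some nonzero power of $x$ acts trivially on $\mathcal{P}(A)$. *)

(* Defs.v *)
From HB Require Import structures.
From mathcomp Require Import all_boot all_order all_algebra.
From mathcomp Require Import boolp classical_sets functions cardinality.

Set Implicit Arguments.
Unset Strict Implicit.
Unset Printing Implicit Defensive.

Import Order.TTheory GRing.Theory Num.Theory.

Local Open Scope classical_set_scope.
Local Open Scope quotient_scope.
Local Open Scope group_scope.

(** ** Groups given by generators and relations *)

(** The letter [(s, true)] stands for the generator [s], and [(s, false)] for
    its formal inverse. *)
Definition word (S : choiceType) := seq (S * bool).

Inductive pres_cong (S : choiceType) (R : word S -> word S -> Prop) :
    word S -> word S -> Prop :=
| PresRefl u : pres_cong R u u
| PresSym u v : pres_cong R u v -> pres_cong R v u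
| PresTrans u v w : pres_cong R u v -> pres_cong R v w -> pres_cong R u w
| PresCat u u' v v' :
    pres_cong R u u' -> pres_cong R v v' -> pres_cong R (u ++ v) (u' ++ v')
| PresInv s b : pres_cong R [:: (s, b); (s, ~~ b)] [::]
| PresRel u v : R u v -> pres_cong R u v.

Definition pres_rel (S : choiceType) (R : word S -> word S -> Prop) :
  rel (word S) := fun u v => `[< pres_cong R u v >].

Lemma pres_rel_refl (S : choiceType) (R : word S -> word S -> Prop) :
  reflexive (pres_rel R).
Proof. by move=> u; apply/asboolP/PresRefl. Qed.

Lemma pres_rel_sym (S : choiceType) (R : word S -> word S -> Prop) :
  symmetric (pres_rel R).
Proof. by move=> u v; apply/asboolP/asboolP => /PresSym. Qed.

Lemma pres_rel_trans (S : choiceType) (R : word S -> word S -> Prop) :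
  transitive (pres_rel R).
Proof. by move=> v u w /asboolP uv /asboolP vw; apply/asboolP/(PresTrans uv). Qed.

Canonical pres_equiv (S : choiceType) (R : word S -> word S -> Prop) :=
  EquivRel (pres_rel R) (@pres_rel_refl S R) (@pres_rel_sym S R)
    (@pres_rel_trans S R).

Definition pres_group (S : choiceType) (R : word S -> word S -> Prop) :=
  {eq_quot pres_equiv R}.

HB.instance Definition _ (S : choiceType) (R : word S -> word S -> Prop) :=
  Choice.on (pres_group R).
HB.instance Definition _ (S : choiceType) (R : word S -> word S -> Prop) :=
  EqQuotient.on (pres_group R).

Definition word_inv (S : choiceType) (u : word S) : word S :=
  rev [seq (a.1, ~~ a.2) | a <- u].

Definition pres_one (S : choiceType) (R : word S -> word S -> Prop) :
  pres_group R := \pi_(pres_group R) [::].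
Definition pres_mul (S : choiceType) (R : word S -> word S -> Prop)
  (x y : pres_group R) : pres_group R :=
  \pi_(pres_group R) (repr x ++ repr y).
Definition pres_inv (S : choiceType) (R : word S -> word S -> Prop)
  (x : pres_group R) : pres_group R :=
  \pi_(pres_group R) (word_inv (repr x)).

Lemma pres_piP (S : choiceType) (R : word S -> word S -> Prop) (u v : word S) :
  pres_cong R u v <-> \pi_(pres_group R) u = \pi_(pres_group R) v.
Proof.
by split=> [uv|/eqmodP/asboolP//]; apply/eqmodP/asboolP.
Qed.

Lemma pres_reprP (S : choiceType) (R : word S -> word S -> Prop) (u : word S) :
  pres_cong R (repr (\pi_(pres_group R) u)) u.
Proof. by apply/pres_piP; rewrite reprK. Qed.

Lemma pres_mulE (S : choiceType) (R : word S -> word S -> Prop) (u v : word S) :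
  pres_mul (\pi_(pres_group R) u) (\pi_(pres_group R) v)
  = \pi_(pres_group R) (u ++ v).
Proof. by apply/pres_piP/PresCat; apply: pres_reprP. Qed.

Lemma pres_congV (S : choiceType) (R : word S -> word S -> Prop) (u : word S) :
  pres_cong R (word_inv u ++ u) [::].
Proof.
elim: u => [|[s b] u IH]; first exact: PresRefl.
rewrite /word_inv map_cons rev_cons -cats1 -catA.
apply: (PresTrans _ IH); apply: PresCat; first exact: PresRefl.
have uE: (s, b) :: u = [:: (s, b)] ++ u by [].
rewrite uE catA -[X in pres_cong _ _ X]cat0s.
apply: PresCat; last exact: PresRefl.
by have := PresInv R s (~~ b); rewrite negbK.
Qed.

Lemma word_invK (S : choiceType) : involutive (@word_inv S).
Proof.
move=> u; rewrite /word_inv map_rev revK -map_comp -[RHS]map_id.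
by apply: eq_map => -[s b] /=; rewrite negbK.
Qed.

Lemma pres_mulA (S : choiceType) (R : word S -> word S -> Prop) :
  associative (@pres_mul S R).
Proof.
elim/quotW=> u; elim/quotW=> v; elim/quotW=> w.
rewrite (pres_mulE R v w) (pres_mulE R u (v ++ w)) catA.
by rewrite (pres_mulE R u v) (pres_mulE R (u ++ v) w).
Qed.

Lemma pres_mul1 (S : choiceType) (R : word S -> word S -> Prop) :
  left_id (pres_one R) (@pres_mul S R).
Proof. by elim/quotW=> u; apply: (pres_mulE R [::] u). Qed.

Lemma pres_mulr1 (S : choiceType) (R : word S -> word S -> Prop) :
  right_id (pres_one R) (@pres_mul S R).
Proof. by elim/quotW=> u; rewrite (pres_mulE R u [::]) cats0. Qed.

Lemma pres_mulV (S : choiceType) (R : word S -> word S -> Prop) :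
  left_inverse (pres_one R) (@pres_inv S R) (@pres_mul S R).
Proof.
move=> x; rewrite /pres_inv -{2}[x]reprK (pres_mulE R _ (repr x)).
exact/pres_piP/pres_congV.
Qed.

Lemma pres_mulrV (S : choiceType) (R : word S -> word S -> Prop) :
  right_inverse (pres_one R) (@pres_inv S R) (@pres_mul S R).
Proof.
move=> x; rewrite /pres_inv -{1}[x]reprK (pres_mulE R (repr x)).
rewrite -{1}[repr x]word_invK.
exact/pres_piP/pres_congV.
Qed.

HB.instance Definition _ (S : choiceType) (R : word S -> word S -> Prop) :=
  isGroup.Build (pres_group R) (@pres_mulA S R) (@pres_mul1 S R)
    (@pres_mulr1 S R) (@pres_mulV S R) (@pres_mulrV S R).

(** ** Artin-Tits groups *)

(** [None] stands for the entry [oo]. *)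
Record cox_matrix (S : finType) := CoxMatrix {
  cox_entry :> S -> S -> option nat;
  cox_sym : forall s t, cox_entry s t = cox_entry t s;
  cox_diag : forall s, cox_entry s s = Some 1%N;
  cox_offdiag : forall s t k,
    s != t -> cox_entry s t = Some k -> (2 <= k)%N
}.

Definition alt_word (S : finType) (s t : S) (k : nat) : word S :=
  mkseq (fun i => (if odd i then t else s, true)) k.

Definition artin_rel (S : finType) (M : cox_matrix S) (u v : word S) : Prop :=
  exists s t k,
    [/\ s != t, M s t = Some k, u = alt_word s t k & v = alt_word t s k].

Definition coxeter_rel (S : finType) (M : cox_matrix S) (u v : word S) : Prop :=
  artin_rel M u v \/ (exists s, u = [:: (s, true); (s, true)] /\ v = [::]).

Definition artin (S : finType) (M : cox_matrix S) := pres_group (artin_rel M).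
HB.instance Definition _ (S : finType) (M : cox_matrix S) :=
  Group.on (artin M).

Definition coxeter (S : finType) (M : cox_matrix S) :=
  pres_group (coxeter_rel M).
HB.instance Definition _ (S : finType) (M : cox_matrix S) :=
  Group.on (coxeter M).

Definition gen (S : finType) (M : cox_matrix S) (s : S) : artin M :=
  \pi_(pres_group (artin_rel M)) [:: (s, true)].

Definition spherical (S : finType) (M : cox_matrix S) : Prop :=
  finite_set [set: coxeter M].

Definition nontrivial_group (G : groupType) : Prop := exists x : G, x <> 1.

Definition irreducible (S : finType) (M : cox_matrix S) : Prop :=
  ~ exists (S1 S2 : finType) (M1 : cox_matrix S1) (M2 : cox_matrix S2)
      (f : {multiplicative artin M -> (artin M1 * artin M2)%type}),
    [/\ nontrivial_group (artin M1), nontrivial_group (artin M2)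
      & bijective f].

(** ** Subsets of a group *)

Definition expgz (G : groupType) (x : G) (p : int) : G :=
  match p with Posz n => x ^+ n | Negz n => x ^- n.+1 end.

Definition is_submonoid (G : groupType) (H : set G) : Prop :=
  H 1 /\ (forall a b, H a -> H b -> H (a * b)).

Definition is_subgroup (G : groupType) (H : set G) : Prop :=
  is_submonoid H /\ (forall a, H a -> H a^-1).

Definition centre (G : groupType) (H : set G) : set G :=
  [set z | H z /\ forall h, H h -> commute z h].

(** [conj_set H g] is [g^-1 H g], since [a ^ g = g^-1 * a * g]. *)
Definition conj_set (G : groupType) (H : set G) (g : G) : set G :=
  [set a ^ g | a in H].

Definition direct_product (G : groupType) (H H1 H2 : set G) : Prop :=
  [/\ H = [set x | exists a b, [/\ H1 a, H2 b & x = a * b]],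
      forall a b, H1 a -> H2 b -> commute a b
    & H1 `&` H2 = [set 1]].

(** ** The Garside structure *)

Definition artin_pos (S : finType) (M : cox_matrix S) : set (artin M) :=
  smallest (@is_submonoid (artin M)) (range (gen M)).

Definition prec (S : finType) (M : cox_matrix S) (a b : artin M) : Prop :=
  artin_pos (a^-1 * b).

(** The least upper bound of the generators for [prec]; it exists in spherical
    type and is unique by antisymmetry. *)
Definition Delta (S : finType) (M : cox_matrix S) : artin M :=
  xget 1 [set d | (forall s, prec (gen M s) d) /\
                  (forall b, (forall s, prec (gen M s) b) -> prec d b)].

Definition simple_elt (S : finType) (M : cox_matrix S) (a : artin M) : Prop :=
  prec 1 a /\ prec a (Delta M).

Definition ginf (S : finType) (M : cox_matrix S) (x : artin M) : int :=
  xget 0%R [set p | prec (expgz (Delta M) p) x /\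
                    forall q, prec (expgz (Delta M) q) x -> (q <= p)%R].

Definition gsup (S : finType) (M : cox_matrix S) (x : artin M) : int :=
  xget 0%R [set p | prec x (expgz (Delta M) p) /\
                    forall q, prec x (expgz (Delta M) q) -> (p <= q)%R].

Definition absorbable (S : finType) (M : cox_matrix S) (y : artin M) : Prop :=
  (ginf y = 0%R \/ gsup y = 0%R) /\
  exists x : artin M, ginf (x * y) = ginf x /\ gsup (x * y) = gsup x.

(** ** Graphs, given by a set-theoretic adjacency relation *)

(** [v] and [w] are at distance at most [n] in the path metric. *)
Definition gdist_le (V : Type) (adj : V -> V -> Prop) (n : nat) (v w : V) :=
  exists (k : nat) (p : nat -> V),
    [/\ (k <= n)%N, p 0%N = v, p k = w
      & forall i, (i < k)%N -> adj (p i) (p i.+1)].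

Definition gbounded (V : Type) (adj : V -> V -> Prop) (B : set V) : Prop :=
  exists n, forall v w, B v -> B w -> gdist_le adj n v w.

(** ** The additional length graph *)

Definition Dcoset (S : finType) (M : cox_matrix S) (g : artin M) :
  set (artin M) := range (fun p : int => g * expgz (Delta M) p).

Definition AL_vertex (S : finType) (M : cox_matrix S) (v : set (artin M)) :=
  exists g, v = Dcoset g.

Definition AL_rep (S : finType) (M : cox_matrix S) (v : set (artin M)) :
  artin M := xget 1 [set a | v a /\ ginf a = 0%R].

Definition AL_edge (S : finType) (M : cox_matrix S) (v w : set (artin M)) :=
  (exists m, [/\ simple_elt m, m <> 1, m <> Delta M & w (AL_rep v * m)]) \/
  (exists y, absorbable y /\ w (AL_rep v * y)).

(** [AL_edge] is in fact symmetric on vertices; the symmetric closure makes the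
    graph undirected by construction. *)
Definition AL_adj (S : finType) (M : cox_matrix S) (v w : set (artin M)) :=
  [/\ AL_vertex v, AL_vertex w & AL_edge v w \/ AL_edge w v].

Definition AL_act (S : finType) (M : cox_matrix S) (x : artin M)
  (v : set (artin M)) : set (artin M) := [set x * a | a in v].

Definition AL_elliptic (S : finType) (M : cox_matrix S) (x : artin M) : Prop :=
  forall v, AL_vertex v ->
    gbounded (@AL_adj S M) (range (fun p : int => AL_act (expgz x p) v)).

(** ** Parabolic subgroups *)

Definition std_parabolic (S : finType) (M : cox_matrix S) (X : {set S}) :
  set (artin M) :=
  smallest (@is_subgroup (artin M)) [set gen M s | s in [set` X]].
Arguments std_parabolic {S} M X _.

Definition parabolic (S : finType) (M : cox_matrix S) (P : set (artin M)) :=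
  exists (X : {set S}) (alpha : artin M),
    P = conj_set (std_parabolic M X) alpha.

Definition irreducible_parabolic (S : finType) (M : cox_matrix S)
  (P : set (artin M)) : Prop :=
  parabolic P /\
  ~ exists Q1 Q2 : set (artin M),
      [/\ parabolic Q1, parabolic Q2, Q1 <> [set 1], Q2 <> [set 1]
        & direct_product P Q1 Q2].

Definition is_zX (S : finType) (M : cox_matrix S) (X : {set S}) (z : artin M) :=
  artin_pos z /\ centre (std_parabolic M X) = range (expgz z).

Definition zP (S : finType) (M : cox_matrix S) (P : set (artin M)) : artin M :=
  xget 1 [set z | exists (X : {set S}) (alpha zX : artin M),
    [/\ P = conj_set (std_parabolic M X) alpha, is_zX X zX
      & z = zX ^ alpha]].

(** ** The complex of irreducible parabolic subgroups *)

Definition PA_vertex (S : finType) (M : cox_matrix S) (P : set (artin M)) :=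
  [/\ irreducible_parabolic P, P <> [set 1] & P <> [set: artin M]].

Definition PA_simplex (S : finType) (M : cox_matrix S)
  (F : set (set (artin M))) : Prop :=
  [/\ finite_set F, F !=set0, (forall P, F P -> PA_vertex P)
    & forall P Q, F P -> F Q -> P <> Q -> commute (zP P) (zP Q)].

(** The left action [P |-> x P x^-1]. *)
Definition PA_act (S : finType) (M : cox_matrix S) (x : artin M)
  (P : set (artin M)) : set (artin M) := conj_set P x^-1.

Definition periodic (S : finType) (M : cox_matrix S) (x : artin M) : Prop :=
  exists p : int, p <> 0%R /\
    forall P, PA_vertex P -> PA_act (expgz x p) P = P.

(** The simplex is preserved as a set: its vertices may be permuted. *)
Definition preserves_simplex (S : finType) (M : cox_matrix S) (x : artin M) :=
  exists F, PA_simplex F /\ [set PA_act x P | P in F] = F.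

Definition normalizes_parabolic (S : finType) (M : cox_matrix S)
  (x : artin M) : Prop :=
  exists P : set (artin M),
    [/\ parabolic P, P <> [set 1], P <> [set: artin M] & PA_act x P = P].

(* Main.v *)
(* Positive words modulo the braid relations act on pairs (greatest reduced
   prefix, remainder); this uses only that the weak order of the finite Coxeter
   group is a meet-semilattice with a greatest element, and it yields
   cancellation, hence the embedding of the positive monoid in the Artin-Tits
   group, the Garside elements D_Y of the standard parabolic subgroups and
   least common multiples.

   Multiplying by Delta^2, which is central, an element x normalizing A_X becomes
   positive; write it as a y with a in A_X^+ and y without left divisor in X.
   Let Y be the complement of a generator outside X. An element b of A_Y^+ not
   divisible by D_Y is absorbed by D_Y^-N Delta^N for large even N, and, as Y
   has at least two elements, each power of D_Y is a product of two such elements,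
   so a has length at most 3. Since y A_X is contained in A_X y, there are generators s
   and t with s y = y t; after division by the largest possible
   s^-k Delta^k, which lies at distance at most 1 because s^k is absorbable, y
   is absorbed by a power of a generator, because lcm(s^n, y) = s^n y. These
   bounds do not depend on x, so they hold for all its powers.

   A simplex contains a parabolic subgroup normalized by a power of x, and a
   periodic element has a power normalizing every subgroup generated by a single
   generator. *)
From HB Require Import structures.
From mathcomp Require Import all_boot all_order all_algebra all_field.
From mathcomp Require Import boolp classical_sets functions cardinality.
From mathcomp Require Import ring zify.
From Stdlib Require Import Setoid Morphisms.
Require Import Defs.

Set Implicit Arguments.
Unset Strict Implicit.
Unset Printing Implicit Defensive.

Import Order.TTheory GRing.Theory Num.Theory.

Local Open Scope quotient_scope.
Local Open Scope group_scope.

(* Rewriting leaves syntactically different, convertible, paths to the group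
   operations of [T], which [lia] would treat as different atoms. *)
Ltac norm_op T op C :=
  repeat match goal with
  | |- context [op ?X] => assert_fails constr_eq X C; change (op X) with (op C)
  | H : context [op ?X] |- _ =>
      assert_fails constr_eq X C; change (op X) with (op C) in H
  end.
Ltac norm_group T :=
  let m := constr:(fun x y : T => x * y) in
  let i := constr:(fun x : T => x^-1) in
  let o := constr:(1 : T) in
  lazymatch m with fun x y => @monoid.mul ?C x y => norm_op T @monoid.mul C end;
  lazymatch i with fun x => @monoid.inv ?C x => norm_op T @monoid.inv C end;
  lazymatch o with @monoid.one ?C => norm_op T @monoid.one C end.
Ltac glia T := norm_group T; lia.

(* The diamond argument of Newman's lemma. *)
Lemma confluent_max (T : Type) (le cov : T -> T -> Prop) (len : T -> nat)
    (E : T -> Prop) (B : nat) (e : T) :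
    (forall x, le x x) -> (forall x y z, le x y -> le y z -> le x z) ->
    (forall x y, cov x y -> le x y /\ len x < len y) ->
    (forall x y, E x -> E y -> le x y ->
      x = y \/ exists z, [/\ cov x z, E z & le z y]) ->
    (forall x, E x -> len x <= B) ->
    (forall x y z, E x -> E y -> E z -> cov x y -> cov x z ->
      exists w, [/\ E w, le y w & le z w]) ->
    E e -> (forall x, E x -> le e x) ->
  exists m, E m /\ forall x, E x -> le x m.
Proof.
move=> lexx le_trans cov_lt le_cov lenB conf Ee le_ex.
(* Induction on the room [B - len x] left above [x]. *)
suff: forall n x, E x -> B - len x <= n ->
    exists m, E m /\ forall y, E y -> le x y -> le y m.
  move=> /(_ _ e Ee (leqnn _)) [m [Em mP]].
  by exists m; split=> // x Ex; apply: mP (le_ex _ Ex).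
elim=> [|n IHn] x Ex len_x.
  exists x; split=> // y Ey /(le_cov _ _ Ex Ey)[->//|[z [/cov_lt[_ xz] Ez _]]].
  by have := lenB _ Ez; lia.
have up z : cov x z -> E z ->
    exists m, E m /\ forall y, E y -> le z y -> le y m.
  by move=> /cov_lt[_ xz] Ez; apply: IHn => //; have := lenB _ Ez; lia.
have [[z [xz Ez]]|Nz] := pselect (exists z, cov x z /\ E z); last first.
  exists x; split=> // y Ey /(le_cov _ _ Ex Ey)[->//|[z [xz Ez _]]].
  by case: Nz; exists z.
have [m [Em mP]] := up z xz Ez.
(* The bound [m] of one cover [z] serves for all: the bound [m'] of another cover [z'] lies above a
   common upper bound of [z] and [z'], hence above [z], hence below [m]. *)
exists m; split=> // y Ey /(le_cov _ _ Ex Ey)[<-|[z' [xz' Ez' z'y]]].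
  by apply: (le_trans _ z); [case: (cov_lt _ _ xz)|exact: mP].
have [m' [Em' m'P]] := up z' xz' Ez'.
have [w [Ew zw z'w]] := conf _ _ _ Ex Ez Ez' xz xz'.
have wm' := m'P _ Ew z'w.
apply: (le_trans _ m'); first exact: m'P.
by apply: mP => //; apply: (le_trans _ w).
Qed.

(** * Alternating words *)

Definition alt (S : Type) (s t : S) (k : nat) : seq S :=
  mkseq (fun i => if odd i then t else s) k.

Section AltWords.
Context {S : eqType}.
Implicit Types s t : S.

Lemma altS s t k : alt s t k.+1 = s :: alt t s k.
Proof.
rewrite /alt /mkseq /= (iotaDl 1 0) -map_comp; congr (_ :: _).
by apply: eq_map => i /=; case: (odd i).
Qed.

Lemma size_alt s t k : size (alt s t k) = k.
Proof. by rewrite size_mkseq. Qed.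

Lemma alt_mem s t k x : x \in alt s t k -> (x == s) || (x == t).
Proof. by elim: k s t => [|k IHk] s t //; rewrite altS inE => /orP[->|/IHk]//; rewrite orbC. Qed.

Lemma altSr s t k : alt s t k.+1 = rcons (alt s t k) (if odd k then t else s).
Proof. by rewrite /alt mkseqS. Qed.

Lemma rev_alt s t k : rev (alt s t k) = if odd k then alt s t k else alt t s k.
Proof.
elim: k s t => [|k IHk] s t //.
by rewrite [in LHS]altSr rev_rcons IHk oddS !altS; case: (odd k).
Qed.
End AltWords.

(** * Coxeter groups: inversions, length, descents and the weak order *)

Section Coxeter.
Context {S : finType} (M : cox_matrix S).
Local Notation W := (coxeter M).
Implicit Types (s t : S) (u v : seq S) (w x y r : W).

Definition wd u : W := \pi_(pres_group (coxeter_rel M)) [seq (s, true) | s <- u].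

Definition sg s : W := wd [:: s].

Lemma wd_cat u v : wd (u ++ v) = wd u * wd v.
Proof. by rewrite /wd map_cat -pres_mulE. Qed.

Lemma wd_nil : wd [::] = 1. Proof. by []. Qed.

Lemma wd_cons s u : wd (s :: u) = sg s * wd u.
Proof. by rewrite -cat1s wd_cat. Qed.

Lemma sgK s : sg s * sg s = 1.
Proof.
rewrite -wd_cat; apply/pres_piP/PresRel; right; by exists s.
Qed.

Lemma sgKl s x : sg s * (sg s * x) = x.
Proof. by rewrite mulgA sgK mul1g. Qed.

Lemma sgKr s x : x * sg s * sg s = x.
Proof. by rewrite -mulgA sgK mulg1. Qed.

Lemma sgV s : (sg s)^-1 = sg s.
Proof. by apply: (mulgI (sg s)); rewrite mulgV sgK. Qed.

Lemma wd_alt s t k : s != t -> M s t = Some k -> wd (alt s t k) = wd (alt t s k).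
Proof.
move=> st Mst; apply/pres_piP/PresRel; left.
by exists s, t, k; split=> //; rewrite /alt /mkseq -map_comp.
Qed.

Lemma wd_word (p : word S) :
  \pi_(pres_group (coxeter_rel M)) p = wd [seq a.1 | a <- p].
Proof.
have neg s : pres_cong (coxeter_rel M) [:: (s, false)] [:: (s, true)].
  apply/pres_piP.
  have -> : \pi_(pres_group (coxeter_rel M)) [:: (s, true)] = sg s by [].
  apply: (mulgI (sg s)); rewrite sgK.
  have := pres_mulE (coxeter_rel M) [:: (s, true)] [:: (s, false)].
  rewrite /sg /wd /= => E; apply: etrans E _.
  exact/pres_piP/(PresInv _ s true).
elim: p => [|[s b] p IHp] //=.
rewrite wd_cons -IHp; apply: etrans (esym (pres_mulE _ [:: (s, true)] p)).
apply/pres_piP; rewrite -cat1s; apply: PresCat; last exact: PresRefl.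
by case: b => //; exact: PresRefl.
Qed.

Lemma wd_surj w : exists u, wd u = w.
Proof. by elim/quotW: w => p; exists [seq a.1 | a <- p]; rewrite wd_word. Qed.

Lemma wd_rev u : wd (rev u) = (wd u)^-1.
Proof.
elim: u => [|s u IHu]; first by rewrite invg1.
by rewrite rev_cons -cats1 wd_cat IHu [in RHS]wd_cons invgM sgV.
Qed.

Section Action.
Context {X : Type} (act : S -> X -> X).
Hypothesis actK : forall s (x : X), act s (act s x) = x.
Hypothesis act_alt : forall s t k (x : X), s != t -> M s t = Some k ->
  foldr act x (alt s t k) = foldr act x (alt t s k).

(** The universal property of the presentation, stated on words. It is applied to [rflip] for the
    exchange condition and to [rep_act] for the orders of products of two generators. *)
Lemma wd_act u v (x : X) : wd u = wd v -> foldr act x u = foldr act x v.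
Proof.
move=> /pres_piP uv.
have fE (p : seq S) z : foldr act z p =
    foldr (fun a => act a.1) z [seq (s, true) | s <- p].
  by elim: p => //= s p ->.
rewrite !fE; elim: uv x => {u v} //.
- by move=> u v w _ IH1 _ IH2 x; rewrite IH1.
- by move=> u u' v v' _ IH1 _ IH2 x; rewrite !foldr_cat IH2 IH1.
- by move=> s b x /=; rewrite actK.
- move=> u v [[s [t [k [st Mst -> ->]]]]|[s [-> ->]]] x /=; last by rewrite actK.
  by have := act_alt x st Mst; rewrite !fE /alt /mkseq -!map_comp.
Qed.
End Action.

(** * The exchange condition *)

(** For a word [s_1 ... s_k] these are the reflections [s_1 ... s_(i-1) s_i s_(i-1) ... s_1]. *)
Fixpoint refls u : seq W :=
  if u is s :: u' then sg s :: [seq sg s * r * sg s | r <- refls u'] else [::].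

Lemma size_refls u : size (refls u) = size u.
Proof. by elim: u => //= s u <-; rewrite size_map. Qed.

(** Multiplying by the [i]-th reflection cancels the prefix around the [i]-th letter, which deletes
    that letter. *)
Lemma refls_del u r : r \in refls u ->
  exists u1 s u2, u = u1 ++ s :: u2 /\ r * wd u = wd (u1 ++ u2).
Proof.
elim: u r => [|s u IHu] r //=; rewrite inE => /orP[/eqP->|/mapP[q qu ->]].
  by exists [::], s, u; split=> //=; rewrite wd_cons sgKl.
have [u1 [t [u2 [-> E]]]] := IHu _ qu.
exists (s :: u1), t, u2; split=> //.
by rewrite cat_cons 2!wd_cons -E -!mulgA sgKl.
Qed.

(* Letting words act on maps [W -> bool] through [rflip] counts modulo 2 the
   occurrences of a reflection among the reflections of a word. *)
Definition rflip s (f : W -> bool) : W -> bool :=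
  fun r => (r == sg s) (+) f (sg s * r * sg s).

Lemma rflip_fold f u r :
  foldr rflip f u r = odd (count_mem r (refls u)) (+) f ((wd u)^-1 * r * wd u).
Proof.
elim: u r => [|s u IHu] r /=; first by rewrite invg1 mulg1 mul1g.
rewrite /rflip IHu wd_cons invgM sgV !mulgA oddD oddb -addbA eq_sym.
congr (_ (+) (odd _ (+) _)).
rewrite count_map; apply: eq_count => q /=.
apply/eqP/eqP => [->|<-]; rewrite !mulgA sgK mul1g sgKr; done.
Qed.

Lemma rflipK s f : rflip s (rflip s f) = f.
Proof.
apply/funext => r; rewrite /rflip !mulgA sgK mul1g sgKr addbA.
rewrite (_ : (sg s * r * sg s == sg s) = (r == sg s)) ?addbb //.
apply/eqP/eqP => [E|->]; last by rewrite sgKr.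
by have := congr1 (fun z => sg s * z * sg s) E; rewrite !mulgA sgK !mul1g sgKr.
Qed.

Lemma wd_alt_double s t k : wd (alt s t k.*2) = (sg s * sg t) ^+ k.
Proof.
elim: k => [|k IHk] //; rewrite doubleS !altS !wd_cons IHk mulgA expgS.
by [].
Qed.

Lemma wd_altV s t k : (wd (alt s t k))^-1 = if odd k then wd (alt s t k) else wd (alt t s k).
Proof. by rewrite -wd_rev rev_alt; case: odd. Qed.

Lemma alt_cat s t k l :
  alt s t (k + l) = alt s t k ++ (if odd k then alt t s l else alt s t l).
Proof.
elim: k s t => [|k IHk] s t //; rewrite addSn !altS IHk cat_cons /=.
by case: (odd k).
Qed.

Lemma wd_alt_order s t k : s != t -> M s t = Some k -> (sg s * sg t) ^+ k = 1.
Proof.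
move=> st Mst; have E := wd_alt st Mst.
rewrite -wd_alt_double -addnn alt_cat wd_cat.
have := wd_altV s t k; have := mulgV (wd (alt s t k)).
by case: (odd k) => E1 E2; rewrite E2 in E1; rewrite -?E // in E1 *.
Qed.

Lemma refls_alt s t k :
  refls (alt s t k) = mkseq (fun j => (sg s * sg t) ^+ j * sg s) k.
Proof.
elim: k s t => [|k IHk] s t //; rewrite altS /= IHk /mkseq /= expg0 mul1g.
congr (_ :: _); rewrite (iotaDl 1 0) -!map_comp; apply: eq_map => j /=.
have E i : sg s * (sg t * sg s) ^+ i = (sg s * sg t) ^+ i * sg s.
  by elim: i => [|i IHi]; rewrite ?expg0 ?mulg1 ?mul1g // !expgS -!mulgA IHi.
by rewrite add1n expgSr !mulgA E.
Qed.

(** As [(sg s * sg t) ^+ k = 1], the reflections of the two alternating words are the same in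
    reverse order, which parities of occurrences do not see. *)
Lemma rflip_alt s t k f : s != t -> M s t = Some k ->
  foldr rflip f (alt s t k) = foldr rflip f (alt t s k).
Proof.
move=> st Mst; apply/funext => r; rewrite !rflip_fold (wd_alt st Mst).
congr (odd _ (+) _).
suff -> : refls (alt s t k) = rev (refls (alt t s k)) by rewrite count_rev.
rewrite !refls_alt; apply: (@eq_from_nth _ 1); rewrite ?size_rev ?size_mkseq//.
move=> i ik; rewrite nth_rev ?size_mkseq // !nth_mkseq //; last by lia.
set g := sg s * sg t; have gk : g ^+ k = 1 by exact: wd_alt_order.
have tsE : sg t * sg s = g^-1 by rewrite invgM !sgV.
have -> : sg t = g^-1 * sg s by rewrite -tsE sgKr.
rewrite mulgA -[g^-1 * sg s * sg s]mulgA sgK mulg1.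
congr (_ * _); rewrite -expgSr subnSK //.
apply: (mulIg (g ^+ (k - i))); rewrite expVgn mulVg -expgnDr subnKC ?gk //.
exact: ltnW.
Qed.

Lemma wlen_exists w : exists n, `[< exists u, size u = n /\ wd u = w >].
Proof. by have [u <-] := wd_surj w; exists (size u); apply/asboolP; exists u. Qed.

Definition wlen w : nat := ex_minn (wlen_exists w).

Lemma wlenP w : exists2 u, wd u = w & size u = wlen w.
Proof. by rewrite /wlen; case: ex_minnP => n /asboolP[u [<- <-]] _; exists u. Qed.

Lemma wlen_le u : wlen (wd u) <= size u.
Proof. by rewrite /wlen; case: ex_minnP => n _; apply; apply/asboolP; exists u. Qed.

Definition reduced u := wlen (wd u) == size u.

(** The characteristic function of the left inversions of [w]. By [wd_act] it does not depend on the
    chosen word, and [rflips_mul] is its cocycle identity. *)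
Definition rflips w : W -> bool := foldr rflip (fun=> false) (xget [::] (fun u => wd u = w)).

Lemma rflips_fold u : rflips (wd u) = foldr rflip (fun=> false) u.
Proof.
apply: (wd_act rflipK (fun s t k f => @rflip_alt s t k f)).
exact: (@xgetPex _ [::] (fun v => wd v = wd u) (ex_intro _ u erefl)).
Qed.

Lemma rflips_wd u r : rflips (wd u) r = odd (count_mem r (refls u)).
Proof. by rewrite rflips_fold rflip_fold addbF. Qed.

Lemma rflips_mul x y r : rflips (x * y) r = rflips x r (+) rflips y (x^-1 * r * x).
Proof.
have [u <-] := wd_surj x; have [v <-] := wd_surj y.
by rewrite -wd_cat !rflips_fold foldr_cat !rflip_fold !addbF.
Qed.

Lemma rflips_sg s r : rflips (sg s) r = (r == sg s).
Proof. by rewrite /sg rflips_wd /= addn0 oddb eq_sym. Qed.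

(** An odd count is positive, so [r] occurs among the reflections of a shortest word, and
    multiplying by it deletes a letter. *)
Lemma rflips_lt w r : rflips w r -> wlen (r * w) < wlen w.
Proof.
have [u <- <-] := wlenP w; rewrite rflips_wd => odd_r.
have [|u1 [s [u2 [-> ->]]]] := @refls_del u r.
  by rewrite -has_pred1 has_count; case: (count _ _) odd_r.
by rewrite (leq_ltn_trans (wlen_le _)) // !size_cat /= addnS ltnS.
Qed.

Lemma wlen1 : wlen 1 = 0.
Proof. by apply/eqP; rewrite -leqn0; apply: (wlen_le [::]). Qed.

Lemma wlen0 w : wlen w = 0 -> w = 1.
Proof. by have [u <- <-] := wlenP w; case: u. Qed.

Lemma wlen_mul x y : wlen (x * y) <= wlen x + wlen y.
Proof.
have [u <- <-] := wlenP x; have [v <- <-] := wlenP y.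
by rewrite -wd_cat -size_cat wlen_le.
Qed.

Lemma wlenV x : wlen x^-1 = wlen x.
Proof.
suff H y : wlen y^-1 <= wlen y by apply/eqP; rewrite eqn_leq H -{1}[x]invgK H.
by have [u <- <-] := wlenP y; rewrite -wd_rev -size_rev wlen_le.
Qed.

Definition ldes s w := rflips w (sg s).

Lemma ldes_sg s w : ldes s (sg s * w) = ~~ ldes s w.
Proof. by rewrite /ldes rflips_mul rflips_sg eqxx mulVg mul1g. Qed.

Lemma wlen_sg_des s w : ldes s w -> wlen w = (wlen (sg s * w)).+1.
Proof.
move=> /rflips_lt; have := wlen_mul (sg s) (sg s * w).
rewrite sgKl; have := wlen_le [:: s]; rewrite -/(sg s) /=; lia.
Qed.

(** By the cocycle identity, if [s] is not a descent of [w] it is one of [sg s * w]. *)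
Lemma wlen_sg_asc s w : ~~ ldes s w -> wlen (sg s * w) = (wlen w).+1.
Proof. by rewrite -ldes_sg => /wlen_sg_des; rewrite sgKl. Qed.

Lemma wlen_sg s : wlen (sg s) = 1%N.
Proof.
by rewrite -[sg s]mulg1 wlen_sg_asc ?wlen1 // /ldes -wd_nil rflips_wd.
Qed.

Lemma reduced_cons s u : reduced (s :: u) = reduced u && ~~ ldes s (wd u).
Proof.
rewrite /reduced wd_cons /=; case: (boolP (ldes s _)) => [/wlen_sg_des E|/wlen_sg_asc ->].
  by rewrite andbF; apply/negbTE; have := wlen_le u; lia.
by rewrite andbT eqSS.
Qed.

Lemma reduced_exists w : exists2 u, reduced u & wd u = w.
Proof. by have [u <- E] := wlenP w; exists u; rewrite // /reduced E. Qed.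

(** The exchange condition shortens a word by deletions only, so no letter outside [P] appears. *)
Lemma reduced_sub (P : pred S) u : all P u ->
  exists v, [/\ all P v, reduced v & wd v = wd u].
Proof.
elim: u => [|s u IHu] /=; first by exists [::]; rewrite /reduced wd_nil wlen1.
case/andP=> Ps /IHu[v [Pv rv Ev]]; rewrite wd_cons -Ev.
have [dsv|] := boolP (ldes s (wd v)); last first.
  by exists (s :: v); split; rewrite ?reduced_cons ?rv ?wd_cons /= ?Ps ?Pv.
have [|v1 [t [v2 [Ev12 E]]]] := @refls_del v (sg s).
  by rewrite -has_pred1 has_count; move: dsv; rewrite /ldes rflips_wd; case: (count _ _).
have sz : size v = (size v1 + size v2).+1 by rewrite Ev12 size_cat addnS.
exists (v1 ++ v2); split; last by rewrite E.
  by move: Pv; rewrite Ev12 !all_cat /= => /and3P[-> _ ->].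
move: rv (wlen_sg_des dsv); rewrite /reduced -E size_cat. lia.
Qed.

Definition red x y := wlen (x * y) == wlen x + wlen y.
(** The weak order, that is the prefix order on reduced expressions. *)
Definition wle x y := wlen y == wlen x + wlen (x^-1 * y).

Lemma wle_mul x y : wle x (x * y) = red x y.
Proof. by rewrite /wle mulKg. Qed.

Lemma wle_refl x : wle x x.
Proof. by rewrite /wle mulVg wlen1 addn0. Qed.

Lemma wle1 x : wle 1 x.
Proof. by rewrite /wle invg1 mul1g wlen1. Qed.

Lemma wle_trans x y z : wle x y -> wle y z -> wle x z.
Proof.
rewrite /wle => /eqP xy /eqP yz; rewrite eqn_leq -{1}[z](mulVKg x) wlen_mul /=.
have := wlen_mul (x^-1 * y) (y^-1 * z).
rewrite !mulgA mulgK. glia (coxeter M).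
Qed.

Lemma wle_anti x y : wle x y -> wle y x -> x = y.
Proof.
rewrite /wle => /eqP xy /eqP yx; have /wlen0 E : wlen (x^-1 * y) = 0 by lia.
by rewrite -[y](mulVKg x) E mulg1.
Qed.

Lemma wle_sg s w : wle (sg s) w = ldes s w.
Proof.
rewrite /wle sgV wlen_sg; case: (boolP (ldes s w)) => [/wlen_sg_des->|/wlen_sg_asc->].
  by rewrite eqxx.
by apply/negbTE; lia.
Qed.

(** Induction on [u]. When [wd u] is a prefix of [w] and [s] is a descent of [w] but not of [wd u],
    the cocycle identity turns [sg s] into an inversion of the remaining factor [(wd u)^-1 * w],
    which is shortened accordingly. *)
Lemma wle_des (P : pred S) w u : (forall s, P s -> ldes s w) ->
  all P u -> reduced u -> wle (wd u) w.
Proof.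
move=> Pw; elim: u => [|s u IHu]; first by rewrite wd_nil wle1.
rewrite reduced_cons /= => /andP[Ps Pu] /andP[ru nsu].
have := IHu Pu ru; rewrite /wle wd_cons invgM sgV (wlen_sg_asc nsu) => /eqP E.
have := Pw s Ps; rewrite /ldes -{1}[w](mulVKg (wd u)) rflips_mul -/(ldes s (wd u)) (negbTE nsu) /=.
move=> /rflips_lt; rewrite !mulgA !mulgK.
rewrite eqn_leq; have := wlen_mul (sg s * wd u) ((wd u)^-1 * sg s * w).
rewrite (wlen_sg_asc nsu) !mulgA mulgK sgK mul1g; glia (coxeter M).
Qed.
End Coxeter.

(** * The geometric representation and the order of a product of two generators *)

Section Representation.
Local Open Scope ring_scope.
Context {S : finType} (M : cox_matrix S) (N : nat).
Hypothesis N_ge2 : (2 <= N)%N.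
Implicit Types (s t q : S) (v w : S -> algC) (fs ft A B z : algC).

(* The geometric representation in coordinates on the simple roots, with
   2 cos (pi / m) replaced by [z + z^-1] for [z] a primitive root of order 2m; the
   entry [None] is read as an arbitrary finite order [N]. *)
Definition ord_at s t : nat := if M s t is Some m then m else N.

Lemma ord_at_sym s t : ord_at s t = ord_at t s.
Proof. by rewrite /ord_at cox_sym. Qed.

Lemma ord_at_ge2 s t : s != t -> (2 <= ord_at s t)%N.
Proof. by rewrite /ord_at; case E: (M s t) => [m|] // st; apply: cox_offdiag E. Qed.

Definition zeta (k : nat) : algC := xget 1 [set z | (k.*2).-primitive_root z].

Lemma zetaP k : (0 < k)%N -> (k.*2).-primitive_root (zeta k).
Proof.
move=> k_gt0; have [|z zP] := @C_prim_root_exists k.*2; first by rewrite double_gt0.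
exact: (@xgetPex _ 1 [set z | (k.*2).-primitive_root z] (ex_intro _ z zP)).
Qed.

Definition cox_coef s t : algC := zeta (ord_at s t) + (zeta (ord_at s t))^-1.

Definition rep_act s v : S -> algC := fun r =>
  if r == s then - v s + \sum_(q | q != s) cox_coef s q * v q else v r.

Lemma rep_actK s v : rep_act s (rep_act s v) = v.
Proof.
apply/funext => r; rewrite /rep_act eqxx; case: eqP => [->|//].
rewrite opprD opprK -addrA [X in _ + X](_ : _ = 0) ?addr0 // addrC.
apply/eqP; rewrite subr_eq0; apply/eqP/eq_bigr => q /negbTE qs.
by rewrite qs.
Qed.

(** The contribution of the coordinates outside the plane of [s] and [t]; it stays constant along
    words in these two letters. *)
Definition offset s t v : algC := \sum_(q | (q != s) && (q != t)) cox_coef s q * v q.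

Lemma rep_act_at s t v : s != t ->
  rep_act s v s = - v s + cox_coef s t * v t + offset s t v.
Proof.
move=> st; rewrite /rep_act eqxx (bigD1 t) 1?eq_sym //= addrA.
by congr (_ + _).
Qed.

Definition run (u : seq S) v := foldl (fun v s => rep_act s v) v u.

(* The plane of [s] and [t] is centred at the fixed point [(fs, ft)], and [A], [B]
   are coordinates on the eigenlines of the rotation. *)
Lemma run_alt k s t fs ft A B v z : s != t -> z != 0 ->
  cox_coef s t = z + z^-1 -> cox_coef t s = z + z^-1 ->
  fs *+ 2 = (z + z^-1) * ft + offset s t v ->
  ft *+ 2 = (z + z^-1) * fs + offset t s v ->
  v s = fs + A / z + B * z -> v t = ft + A + B ->
  let w := run (alt s t k) v in
  [/\ forall q, q != s -> q != t -> w q = v q,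
      w (if odd k then t else s) =
        (if odd k then ft else fs) + A * z ^+ k / z + B * z / z ^+ k &
      w (if odd k then s else t) =
        (if odd k then fs else ft) + A * z ^+ k + B / z ^+ k].
Proof.
move=> + z0; elim: k s t fs ft A B v => [|k IHk] s t fs ft A B v st cst cts hs ht vs vt.
  by split; rewrite //= expr0 ?divr1 ?mulr1.
rewrite altS /=; set v1 := rep_act s v.
have v1E q : q != s -> v1 q = v q by rewrite /v1 /rep_act => /negbTE->.
have off1 : offset s t v1 = offset s t v.
  by apply: eq_bigr => q /andP[qs _]; rewrite v1E.
have off2 : offset t s v1 = offset t s v.
  by apply: eq_bigr => q /andP[_ qs]; rewrite v1E.
have ts : t != s by rewrite eq_sym.
have fsE : offset s t v = fs *+ 2 - (z + z^-1) * ft by rewrite hs addrC addKr.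
have [||||w1 w2 w3] := IHk t s ft fs (A * z) (B / z) v1 ts cts cst.
- by rewrite off2 ht.
- by rewrite off1 hs.
- by rewrite v1E // vt mulfK // mulfVK.
- by rewrite /v1 (rep_act_at _ st) cst vs vt fsE; field.
split=> [q qs qt||].
- by rewrite w1 // v1E.
- move: w2; rewrite /run if_neg => ->.
  by case: (odd k) => /=; rewrite exprS; field; rewrite expf_neq0 z0.
- move: w3; rewrite /run if_neg => ->.
  by case: (odd k) => /=; rewrite exprS; field; rewrite expf_neq0 z0.
Qed.

Lemma zetaX k : (0 < k)%N -> zeta k ^+ k = -1.
Proof.
move=> k_gt0; have zk := zetaP k_gt0.
have : (zeta k ^+ k) ^+ 2 = 1 by rewrite -exprM muln2 prim_expr_order.
move/eqP; rewrite sqrf_eq1 => /orP[|/eqP//].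
rewrite -(prim_order_dvd zk) => /dvdn_leq; lia.
Qed.

Lemma zeta_neq0 k : (0 < k)%N -> zeta k != 0.
Proof.
move=> k_gt0; apply/eqP => z0; have /eqP := zetaX k_gt0.
by rewrite z0 expr0n eqn0Ngt k_gt0 eq_sym oppr_eq0 oner_eq0.
Qed.

Lemma zeta_sub k : (2 <= k)%N -> zeta k - (zeta k)^-1 != 0.
Proof.
move=> k2; have z0 : zeta k != 0 by rewrite zeta_neq0 //; lia.
rewrite subr_eq0 -(inj_eq (mulIf z0)) mulVf // -expr2.
rewrite -(prim_order_dvd (zetaP _)); last by lia.
by apply/negP => /dvdn_leq; lia.
Qed.

(** As [z ^+ m = -1], either word negates the displacement from the fixed point, up to exchanging
    the two coordinates when [m] is odd. *)
Lemma run_alt_ord s t v : s != t ->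
  run (alt s t (ord_at s t)) v = run (alt t s (ord_at s t)) v.
Proof.
move=> st; set m := ord_at s t; have m2 : (2 <= m)%N by exact: ord_at_ge2.
have ts : t != s by rewrite eq_sym.
set z := zeta m; have z0 : z != 0 by rewrite zeta_neq0 //; lia.
have zm : z ^+ m = -1 by rewrite zetaX //; lia.
have D0 : z - z^-1 != 0 by exact: zeta_sub.
have z21 : z ^+ 2 - 1 != 0.
  by apply: contraNneq D0 => E; rewrite (_ : z - z^-1 = (z ^+ 2 - 1) / z); [rewrite E mul0r|field].
have cst : cox_coef s t = z + z^-1 by [].
have cts : cox_coef t s = z + z^-1 by rewrite /cox_coef ord_at_sym.
pose hs := offset s t v; pose ht := offset t s v.
(* The linear system for the fixed point has determinant [- (z - z^-1) ^+ 2], which is nonzero;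
   [amp] solves for the coordinate [B] of [run_alt]. *)
pose fs := - (hs *+ 2 + (z + z^-1) * ht) / (z - z^-1) ^+ 2.
pose ft := - (ht *+ 2 + (z + z^-1) * hs) / (z - z^-1) ^+ 2.
pose amp x y : algC := (x - y / z) / (z - z^-1).
have fsE : fs *+ 2 = (z + z^-1) * ft + hs by rewrite /fs /ft; field; rewrite ?z0.
have ftE : ft *+ 2 = (z + z^-1) * fs + ht by rewrite /fs /ft; field; rewrite ?z0.
have ampE x y f g : [/\ x = f + (y - g - amp (x - f) (y - g)) / z + amp (x - f) (y - g) * z
    & y = g + (y - g - amp (x - f) (y - g)) + amp (x - f) (y - g)].
  by split; rewrite /amp; field; rewrite ?z0.
have [E1 E2] := ampE (v s) (v t) fs ft.
have [E3 E4] := ampE (v t) (v s) ft fs.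
have [a1 a2 a3] := run_alt m st z0 cst cts fsE ftE E1 E2.
have [b1 b2 b3] := run_alt m ts z0 cts cst ftE fsE E3 E4.
apply/funext => q; have [->|qs] := eqVneq q s; last have [->|qt] := eqVneq q t.
- move: a2 a3 b2 b3; rewrite zm; case: (odd m) => /= a2 a3 b2 b3.
    by rewrite a3 b2 /amp; field; rewrite ?z0.
  by rewrite a2 b3 /amp; field; rewrite ?z0.
- move: a2 a3 b2 b3; rewrite zm; case: (odd m) => /= a2 a3 b2 b3.
    by rewrite a2 b3 /amp; field; rewrite ?z0.
  by rewrite a3 b2 /amp; field; rewrite ?z0.
- by rewrite a1 // b1.
Qed.

Lemma rep_alt s t k v : s != t -> M s t = Some k ->
  foldr rep_act v (alt s t k) = foldr rep_act v (alt t s k).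
Proof.
move=> st Mst; have := run_alt_ord v st; rewrite /ord_at Mst.
have H u : foldr rep_act v u = run (rev u) v by rewrite /run foldl_rev.
by rewrite !H !rev_alt; case: odd.
Qed.

(** The rotation has eigenvalues [z ^+ 2] and its inverse. Fixing the simple root of [s], its [i]-th
    power would force [z ^+ i.*2 = 1], while [z] has order twice [ord_at s t]. *)
Lemma sg_mul_order s t i : s != t -> (0 < i < ord_at s t)%N ->
  ((sg M s * sg M t) ^+ i <> 1)%g.
Proof.
move=> st /andP[i0 im]; rewrite -wd_alt_double -wd_nil => E.
pose v q : algC := (q == s)%:R.
have := wd_act rep_actK (@rep_alt) v E.
have -> : foldr rep_act v (alt s t i.*2) = run (alt t s i.*2) v.
  by rewrite -[alt t s _]revK rev_alt odd_double /run foldl_rev.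
set m := ord_at s t in im *; set z := zeta m.
have m2 : (2 <= m)%N by exact: ord_at_ge2.
have z0 : z != 0 by rewrite zeta_neq0 //; lia.
have D0 : z - z^-1 != 0 by exact: zeta_sub.
have ts : t != s by rewrite eq_sym.
have off0 a b : a != b -> (a == s) || (b == s) -> offset a b v = 0.
  move=> ab abs; apply: big1 => q /andP[qa qb]; rewrite /v.
  case: eqP => [qs|]; rewrite ?mulr0 //; move: abs.
  by rewrite -qs ![_ == q]eq_sym (negbTE qa) (negbTE qb).
have cst : cox_coef s t = z + z^-1 by [].
have cts : cox_coef t s = z + z^-1 by rewrite /cox_coef ord_at_sym.
pose B : algC := - z^-1 / (z - z^-1).
have h1 : 0 *+ 2 = (z + z^-1) * 0 + offset t s v.
  by rewrite off0 ?eqxx ?orbT // mul0rn mulr0 addr0.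
have h2 : 0 *+ 2 = (z + z^-1) * 0 + offset s t v.
  by rewrite off0 ?eqxx // mul0rn mulr0 addr0.
have z21 : z ^+ 2 - 1 != 0.
  by apply: contraNneq D0 => E'; rewrite (_ : z - z^-1 = (z ^+ 2 - 1) / z); [rewrite E' mul0r|field].
have v1 : v t = 0 + (1 - B) / z + B * z by rewrite /v (negbTE ts) mulr0n /B; field; rewrite ?z0.
have v2 : v s = 0 + (1 - B) + B by rewrite /v eqxx mulr1n /B; ring.
have [_ +  + Ev] := run_alt i.*2 ts z0 cts cst h1 h2 v1 v2.
rewrite odd_double /= => w1 w2; rewrite Ev in w1 w2.
set y := z ^+ i.*2 in w1 w2.
have y0 : y != 0 by rewrite expf_neq0.
(* The vanishing of the [t]-coordinate gives [y ^+ 2 = 1]; the value 1 of the [s]-coordinate then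
   gives [y = 1]. *)
have y2 : y ^+ 2 = 1.
  apply/eqP; rewrite -subr_eq0; apply/eqP.
  have -> : y ^+ 2 - 1 = y * (z - z^-1) * (0 + (1 - B) * y / z + B * z / y).
    by rewrite /B; field; rewrite ?z0 ?y0.
  by rewrite -w1 /= /v (negbTE ts) mulr0.
have y1 : y = 1.
  have -> : y = 0 + (1 - B) * y + B / y + (y ^+ 2 - 1) * B / y.
    by rewrite /B; field; rewrite ?z0 ?y0.
  by rewrite y2 subrr !mul0r addr0 -w2 /= /v eqxx.
have /eqP := y1; rewrite -(prim_order_dvd (zetaP _)); last by lia.
by move/dvdn_leq; lia.
Qed.
End Representation.

(** * Positive words modulo the braid relations *)

Section PositiveWords.
Context {S : finType} (M : cox_matrix S).
Implicit Types (s t : S) (u v w : seq S).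

Inductive pcong : seq S -> seq S -> Prop :=
| PcongRefl u : pcong u u
| PcongSym u v : pcong u v -> pcong v u
| PcongTrans u v w : pcong u v -> pcong v w -> pcong u w
| PcongCat u u' v v' : pcong u u' -> pcong v v' -> pcong (u ++ v) (u' ++ v')
| PcongAlt s t k : s != t -> M s t = Some k -> pcong (alt s t k) (alt t s k).

Lemma pcong_catl u v v' : pcong v v' -> pcong (u ++ v) (u ++ v').
Proof. by move=> vv'; apply: PcongCat => //; apply: PcongRefl. Qed.

Lemma pcong_catr u u' v : pcong u u' -> pcong (u ++ v) (u' ++ v).
Proof. by move=> uu'; apply: PcongCat => //; apply: PcongRefl. Qed.

Lemma pcong_cons s u v : pcong u v -> pcong (s :: u) (s :: v).
Proof. exact: (@pcong_catl [:: s]). Qed.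

Lemma pcong_size u v : pcong u v -> size u = size v.
Proof.
elim=> {u v} [//|//|u v w _ -> _ ->//|u u' v v' _ E1 _ E2|s t k _ _].
  by rewrite !size_cat E1 E2.
by rewrite !size_alt.
Qed.

(** Both sides of a braid relation have at least two letters, hence the same support. *)
Lemma pcong_mem u v : pcong u v -> u =i v.
Proof.
elim=> {u v} [//|u v _ E x|u v w _ E1 _ E2 x|u u' v v' _ E1 _ E2 x|s t k st Mst x].
- by rewrite E.
- by rewrite E1 E2.
- by rewrite !mem_cat E1 E2.
have := cox_offdiag st Mst; case: k {Mst} => [|[|k]] // _.
by rewrite !altS !inE; apply/idP/idP => /or3P[->|->|/alt_mem/orP[]->]; rewrite ?orbT.
Qed.

Lemma pcong_all (P : pred S) u v : pcong u v -> all P u = all P v.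
Proof. by move=> /pcong_mem uv; apply: eq_all_r. Qed.

Lemma pcong_wd u v : pcong u v -> wd M u = wd M v.
Proof.
elim=> {u v} [//|u v _ ->//|u v w _ -> _ ->//|u u' v v' _ E1 _ E2|s t k].
  by rewrite !wd_cat E1 E2.
exact: wd_alt.
Qed.

Lemma pcong_rev u v : pcong u v -> pcong (rev u) (rev v).
Proof.
elim=> {u v} [u|u v _ E|u v w _ E1 _ E2|u u' v v' _ E1 _ E2|s t k st Mst].
- exact: PcongRefl.
- exact: PcongSym.
- exact: PcongTrans E1 E2.
- by rewrite !rev_cat; apply: PcongCat.
rewrite !rev_alt; case: odd; last apply: PcongSym; exact: PcongAlt.
Qed.
End PositiveWords.

(** * Finite Coxeter groups *)

Section Finite.
Context {S : finType} (M : cox_matrix S).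
Hypothesis Mspherical : spherical M.
Local Notation W := (coxeter M).
Local Notation wd := (wd M).
Local Notation sg := (sg M).
Implicit Types (s t : S) (u v : seq S) (w x y a b c : W) (P : pred S).

Lemma wlen_bounded : exists B, forall w, wlen w <= B.
Proof.
have /finite_seqP[l lP] := Mspherical.
exists (\max_(w <- l) wlen w) => w; apply: (@leq_bigmax_seq _ l xpredT (@wlen _ M)) => //.
by have : [set: W]%classic w by []; rewrite lP.
Qed.

(** Each reflection of [u] occurs once, hence an odd number of times, so it also occurs for a
    reduced word of the same element, which is then at least as long as [u]. *)
Lemma refls_uniq_reduced u : uniq (refls M u) -> reduced M u.
Proof.
move=> uq; rewrite /reduced eqn_leq wlen_le /=.
have [v ru E] := reduced_exists (wd u).
have := ru; rewrite /reduced E => /eqP ->.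
rewrite -(size_refls M u) -(size_refls M v); apply: uniq_leq_size => // r ru'.
have : rflips (wd u) r by rewrite rflips_wd count_uniq_mem ?ru'.
by rewrite -E rflips_wd -has_pred1 has_count; case: count.
Qed.

Lemma alt_reduced_ord N s t k : 2 <= N -> s != t -> k <= ord_at M N s t ->
  reduced M (alt s t k).
Proof.
move=> N2 st kN; apply: refls_uniq_reduced; rewrite refls_alt.
apply/mkseq_uniqP => i j; rewrite !inE.
wlog ij : i j / i <= j => [H ik jk E|ik jk].
  by have [/H|/ltnW/H] := leqP i j; [apply|move=> ->].
move/(mulIg (sg s)) => E; apply/eqP; rewrite eqn_leq ij leqNgt; apply/negP => lij.
apply: (@sg_mul_order S M N N2 s t (j - i)) => //; first lia.
by apply: (mulgI ((sg s * sg t) ^+ i)); rewrite -expgnDr subnKC // mulg1 E.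
Qed.

Lemma cox_entry_finite s t : s != t -> exists m, M s t = Some m.
Proof.
move=> st; case E: (M s t) => [m|]; first by exists m.
have [B wlenB] := wlen_bounded.
(* With an infinite entry read as [B.+2], the alternating word of that length would be reduced and
   longer than every element of [W]. *)
have := @alt_reduced_ord B.+2 s t B.+2 isT st; rewrite /ord_at E => /(_ (leqnn _)).
by rewrite /reduced size_alt => /eqP E'; have := wlenB (wd (alt s t B.+2)); lia.
Qed.

Lemma alt_reduced s t m : s != t -> M s t = Some m -> reduced M (alt s t m).
Proof. by move=> st Mst; apply: (@alt_reduced_ord 2) => //; rewrite /ord_at Mst. Qed.

Lemma reduced_cat u v : reduced M u -> reduced M v ->
  reduced M (u ++ v) = red (wd u) (wd v).
Proof. by rewrite /reduced /red wd_cat size_cat => /eqP -> /eqP ->. Qed.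

(* Matsumoto's theorem. *)
Lemma reduced_pcong u v : reduced M u -> reduced M v -> wd u = wd v -> pcong M u v.
Proof.
move: {-1}(size u) (erefl (size u)) => n; elim: n u v => [|n IHn] u v su ru rv E.
  have : size v = 0 by have := rv; rewrite /reduced -E (eqP ru) su => /eqP.
  by move/size0nil=> ->; rewrite (size0nil su); apply: PcongRefl.
case: u su ru E => [//|s u] [su] ru E.
case: v rv E => [|t v] rv E.
  by have := ru; rewrite /reduced E wd_nil wlen1.
have IH q z : size z = n -> reduced M (q :: z) -> forall z', reduced M (q :: z') ->
    wd (q :: z) = wd (q :: z') -> pcong M (q :: z) (q :: z').
  move=> sz; rewrite reduced_cons => /andP[rz _] z'; rewrite reduced_cons => /andP[rz' _].
  by rewrite !wd_cons => /mulgI Ez; apply/pcong_cons/IHn.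
have [st|st] := eqVneq s t; first by move: rv E; rewrite -st; exact: IH.
have sv : size v = n.
  by have := ru; have := rv; rewrite /reduced E => /eqP -> /eqP []; rewrite su.
have [m Mst] := cox_entry_finite st; have m2 := cox_offdiag st Mst.
pose w := wd (s :: u).
(* Both first letters are descents of [w], so [wle_des] makes the full alternating word a prefix of
   [w]. The two resulting words for [w], starting with [s] and [t], link [s :: u] to [t :: v]
   through one braid relation. *)
have dw q : pred2 s t q -> ldes q w.
  case/pred2P=> ->; first rewrite /w; last rewrite /w E;
  by rewrite wd_cons ldes_sg; move: ru rv; rewrite !reduced_cons => /andP[_ ?] /andP[_ ?].
have wA : wle (wd (alt s t m)) w.
  apply: (wle_des dw); last exact: alt_reduced.
  by apply/allP => q /alt_mem.
have [z rz Ez] := reduced_exists ((wd (alt s t m))^-1 * w).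
have ts : t != s by rewrite eq_sym.
have Mts : M t s = Some m by rewrite cox_sym.
have A1 := alt_reduced st Mst; have A2 := alt_reduced ts Mts.
have EA := wd_alt st Mst.
have ER : red (wd (alt s t m)) (wd z) by rewrite Ez -wle_mul mulVKg.
have R1 : reduced M (alt s t m ++ z) by rewrite reduced_cat.
have R2 : reduced M (alt t s m ++ z) by rewrite reduced_cat // -EA.
have W1 : wd (s :: u) = wd (alt s t m ++ z) by rewrite wd_cat Ez mulVKg.
have W2 : wd (t :: v) = wd (alt t s m ++ z) by rewrite -E W1 !wd_cat EA.
case: m m2 {Mts wA Ez EA ER A1 A2} Mst R1 R2 W1 W2 => // m _ Mst.
move=> R1 R2 W1 W2; apply: PcongTrans (_ : pcong M (alt s t m.+1 ++ z) _).
  by move: R1 W1; rewrite altS; apply: IH.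
apply: PcongTrans (pcong_catr z (PcongAlt st Mst)) _; apply: PcongSym.
by move: R2 W2; rewrite altS; apply: IH.
Qed.

(** * Longest elements of parabolic subgroups and meets for the weak order *)

Definition in_para P w := exists2 u, all P u & wd u = w.

Lemma in_para_reduced P w : in_para P w -> exists u, [/\ all P u, reduced M u & wd u = w].
Proof. by case=> u /reduced_sub - /(_ M)[v [Pv rv <-]] <-; exists v. Qed.

Lemma in_paraM P x y : in_para P x -> in_para P y -> in_para P (x * y).
Proof. by case=> u Pu <- [v Pv <-]; exists (u ++ v); rewrite ?all_cat ?Pu ?wd_cat. Qed.

Lemma in_paraV P x : in_para P x -> in_para P x^-1.
Proof. by case=> u Pu <-; exists (rev u); rewrite ?all_rev ?wd_rev. Qed.

Lemma in_para_sg P s : P s -> in_para P (sg s).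
Proof. by move=> Ps; exists [:: s]; rewrite //= Ps. Qed.

Definition longest P : W :=
  xget 1 [set w | in_para P w /\ forall s, P s -> ldes s w].

(** An element of maximal length in the parabolic subgroup cannot be lengthened by a letter of
    [P]. *)
Lemma longestP P : in_para P (longest P) /\ forall s, P s -> ldes s (longest P).
Proof.
have [B wlenB] := wlen_bounded.
pose p n := `[< exists2 w, in_para P w & wlen w = n >].
have ex0 : exists n, p n.
  by exists 0%N; apply/asboolP; exists 1; [exists [::]|exact: wlen1].
have pB n : p n -> n <= B by move/asboolP=> [w _ <-].
case: (ex_maxnP ex0 pB) => n /asboolP[w Pw <-] wmax.
apply: (@xgetPex _ 1 [set w | in_para P w /\ forall s, P s -> ldes s w]).
exists w; split=> // s Ps; apply/negPn/negP => /wlen_sg_asc E.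
have := wmax (wlen (sg s * w)); rewrite E ltnn => H; suff: false by []; apply: H.
by apply/asboolP; exists (sg s * w) => //; apply: in_paraM => //; apply: in_para_sg.
Qed.

Lemma longest_le P w : (forall s, P s -> ldes s w) -> wle (longest P) w.
Proof.
move=> dw; have [/in_para_reduced[u [Pu ru <-]] _] := longestP P.
exact: wle_des dw Pu ru.
Qed.

Lemma wlen_mul_longest P x : in_para P x ->
  wlen (longest P) = wlen x + wlen (x * longest P).
Proof.
move=> /in_paraV/in_para_reduced[u [Pu ru Eu]].
have [_ /wle_des/(_ Pu ru)] := longestP P.
by rewrite Eu /wle wlenV invgK => /eqP.
Qed.

Lemma longestK P : longest P * longest P = 1.
Proof. by have := wlen_mul_longest (longestP P).1 => E; apply: wlen0; glia (coxeter M). Qed.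

(** The conjugate of [sg s] has length 1: the complement formula [wlen_mul_longest] applied to
    [l * sg s], of length one less than [l], leaves length 1 for [l * sg s * l]. *)
Lemma longest_conj P s : P s -> exists t,
  [/\ P t, sg s * longest P = longest P * sg t & sg t * longest P = longest P * sg s].
Proof.
move=> Ps; set l := longest P; have [Pl dl] := longestP P.
have lV : l^-1 = l by apply: (mulgI l); rewrite mulgV longestK.
have Plsl : in_para P (l * sg s * l).
  by apply: in_paraM => //; apply: in_paraM => //; apply: in_para_sg.
have len1 : wlen (l * sg s * l) = 1%N.
  have := wlen_mul_longest (in_paraM Pl (in_para_sg Ps)).
  rewrite -/l -[wlen (l * sg s)]wlenV invgM lV sgV.
  by have := wlen_sg_des (dl _ Ps); rewrite -/l => E1 E2; glia (coxeter M).
have [u [Pu /eqP ru Eu]] := in_para_reduced Plsl.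
rewrite Eu len1 in ru; move: ru Pu Eu; case: u => [//|t [|//]] _ /=; rewrite andbT => Pt.
rewrite -/(sg t) => Et; exists t; split=> //; rewrite Et.
  by rewrite !mulgA longestK mul1g.
by rewrite -!mulgA longestK mulg1.
Qed.

Lemma wle_mulr x c y : wle x y -> wle c (x^-1 * y) -> wle (x * c) y && red x c.
Proof.
rewrite /wle /red => /eqP xy; rewrite -{1}(mul1g (_ * y)) => /eqP.
rewrite mul1g => cy.
have := wlen_mul (x * c) ((x * c)^-1 * y); have := wlen_mul x c.
rewrite mulVKg invgM -[c^-1 * x^-1 * y]mulgA.
move=> E1 E2; apply/andP; split; apply/eqP; glia (coxeter M).
Qed.

Lemma wle_mull x c y : red x c -> wle (x * c) y -> wle x y && wle c (x^-1 * y).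
Proof.
move=> rxc xcy; have xy : wle x y by apply: wle_trans xcy; rewrite wle_mul.
rewrite xy; move: rxc xcy xy; rewrite /wle /red => /eqP E1 /eqP E2 /eqP E3.
by apply/eqP; move: E2; rewrite invgM -mulgA => E2; glia (coxeter M).
Qed.

Lemma wle_mul2 x c d : red x c -> wle d c -> wle (x * d) (x * c) && red x d.
Proof.
move=> rxc dc; apply: wle_mulr; first by rewrite wle_mul.
by rewrite mulKg.
Qed.

(** This is [confluent_max] for the common prefixes: two covers [x * sg s] and [x * sg t] of [x] are
    joined by [x] times the longest element in [s] and [t]. *)
Lemma meet_exists a b : exists m, (wle m a /\ wle m b) /\
  forall x, wle x a /\ wle x b -> wle x m.
Proof.
apply: (@confluent_max _ (fun x y => wle x y)
  (fun x y => exists2 s, y = x * sg s & wlen y = (wlen x).+1)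
  (@wlen _ M) (fun x => wle x a /\ wle x b) (wlen a) 1).
- exact: wle_refl.
- exact: wle_trans.
- move=> x y [s -> E]; split; last by rewrite E.
  by rewrite wle_mul /red E wlen_sg addn1.
- move=> x y [xa xb] [ya yb] xy.
  have [u ru Eu] := reduced_exists (x^-1 * y).
  case: u ru Eu => [_ E|s u rsu Eu].
    by left; rewrite -[y](mulVKg x) -E wd_nil mulg1.
  have sxy : wle (sg s) (x^-1 * y).
    by rewrite -Eu wle_sg wd_cons ldes_sg; move: rsu; rewrite reduced_cons => /andP[].
  have /andP[xsy /eqP xs] := wle_mulr xy sxy.
  right; exists (x * sg s); split=> //.
    by exists s => //; rewrite xs wlen_sg addn1.
  by split; apply: wle_trans xsy _.
- by move=> x [/eqP -> _]; rewrite leq_addr.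
- move=> x y z [xa xb] [ya yb] [za zb] [s ys ly] [t zt lz].
  have rs : red x (sg s) by rewrite /red -ys ly wlen_sg addn1.
  have rt : red x (sg t) by rewrite /red -zt lz wlen_sg addn1.
  have join c : wle y c -> wle z c ->
      wle (x * longest (pred2 s t)) c && red x (longest (pred2 s t)).
    rewrite ys zt => /(wle_mull rs)/andP[xc sc] /(wle_mull rt)/andP[_ tc].
    apply: wle_mulr => //; apply: longest_le => q /pred2P[]->; by rewrite -wle_sg.
  have /andP[ja rj] := join _ ya za; have /andP[jb _] := join _ yb zb.
  have [_ dl] := longestP (pred2 s t).
  have ls : wle (sg s) (longest (pred2 s t)) by rewrite wle_sg dl //= eqxx.
  have lt : wle (sg t) (longest (pred2 s t)) by rewrite wle_sg dl //= eqxx orbT.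
  exists (x * longest (pred2 s t)); split=> //; rewrite ?ys ?zt.
    by case/andP: (wle_mul2 rj ls).
  by case/andP: (wle_mul2 rj lt).
- by split; apply: wle1.
- by move=> x _; apply: wle1.
Qed.

Definition meet a b : W :=
  xget 1 [set m | (wle m a /\ wle m b) /\ forall x, wle x a /\ wle x b -> wle x m].

Lemma meetP a b : (wle (meet a b) a /\ wle (meet a b) b) /\
  forall x, wle x a /\ wle x b -> wle x (meet a b).
Proof. exact: (xgetPex 1 (meet_exists a b)). Qed.
End Finite.

#[local] Hint Resolve PcongRefl : core.

#[local] Instance pcong_equiv (S : finType) (M : cox_matrix S) : Equivalence (pcong M).
Proof.
split; [exact: PcongRefl|exact: PcongSym|move=> u v w; exact: PcongTrans].
Qed.

#[local] Instance pcong_cat_proper (S : finType) (M : cox_matrix S) :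
  Proper (pcong M ==> pcong M ==> pcong M) (@cat S).
Proof. by move=> u u' uu' v v' vv'; apply: PcongCat. Qed.

#[local] Instance pcong_cons_proper (S : finType) (M : cox_matrix S) (s : S) :
  Proper (pcong M ==> pcong M) (cons s).
Proof. by move=> u u' uu'; apply: pcong_cons. Qed.

(** * The positive monoid: normal forms, cancellation and Garside words *)

Section Monoid.
Context {S : finType} (M : cox_matrix S).
Hypothesis Mspherical : spherical M.
Local Notation W := (coxeter M).
Local Notation wd := (wd M).
Local Notation sg := (sg M).
Local Notation pcong := (pcong M).
Local Notation longest := (longest M).
Implicit Types (s t : S) (u v : seq S) (w x y a b c : W) (P : pred S).

(** A chosen representative of each class turns [pcong] into equality, so that remainders in normal
    forms can be compared by [=]. *)
Definition canon u : seq S := xget [::] [set v | pcong u v].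

Lemma canonP u : pcong (canon u) u.
Proof.
apply: PcongSym; apply: (@xgetPex _ [::] [set v | pcong u v]).
by exists u; apply: PcongRefl.
Qed.

Lemma canon_eq u v : pcong u v -> canon u = canon v.
Proof.
move=> uv; rewrite /canon; congr (xget _ _); apply/funext => z; apply/propext.
by split=> /=; [apply: PcongTrans (PcongSym uv)|apply: PcongTrans uv].
Qed.

Lemma canon_inj u v : canon u = canon v -> pcong u v.
Proof. by move=> E; rewrite -(canonP u) E canonP. Qed.

Definition rw w : seq S := xget [::] [set u | reduced M u /\ wd u = w].

Lemma rwP w : reduced M (rw w) /\ wd (rw w) = w.
Proof.
apply: (@xgetPex _ [::] [set u | reduced M u /\ wd u = w]).
by have [u ru E] := reduced_exists w; exists u.
Qed.

Lemma rw_pcong u : reduced M u -> pcong (rw (wd u)) u.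
Proof. by move=> ru; have [r E] := rwP (wd u); apply: reduced_pcong. Qed.

Lemma rw_mul x y : red x y -> pcong (rw (x * y)) (rw x ++ rw y).
Proof.
move=> rxy; have [rx Ex] := rwP x; have [ry Ey] := rwP y.
by rewrite -{1}Ex -{1}Ey -wd_cat; apply: rw_pcong; rewrite reduced_cat // Ex Ey.
Qed.

Lemma rw_sg s : pcong (rw (sg s)) [:: s].
Proof. by apply: rw_pcong; rewrite /reduced -/(sg s) wlen_sg. Qed.

Lemma size_rw w : size (rw w) = wlen w.
Proof. by have [/eqP <- ->] := rwP w. Qed.

Definition w0 : W := longest predT.

Lemma wlen_w0 x : wlen w0 = wlen x + wlen (x * w0).
Proof.
apply: wlen_mul_longest => //; have [u ru <-] := reduced_exists x.
by exists u => //; apply/allP.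
Qed.

(** Lengths are compared through complements in [w0]. Being a reduced product becomes a bound in the
    weak order, so the largest prefix of [w] that can be attached to [x] is the meet [hd x w]. *)
Lemma red_w0 x y : red x y = wle y (x^-1 * w0).
Proof.
rewrite /red /wle; have := wlen_w0 x^-1; rewrite wlenV => E1.
have := wlen_w0 (x * y)^-1; rewrite wlenV invgM -mulgA => E2.
by apply/eqP/eqP => E; glia (coxeter M).
Qed.

Definition hd x w : W := meet w (x^-1 * w0).

Lemma hdP x w : [/\ wle (hd x w) w, red x (hd x w) &
  forall y, wle y w -> red x y -> wle y (hd x w)].
Proof.
have [[h1 h2] h3] := meetP Mspherical w (x^-1 * w0).
by split; rewrite ?red_w0 // => y yw; rewrite red_w0 => yx; apply: h3.
Qed.

(* [(w, l)] stands for the element of the positive monoid with greatest reduced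
   prefix [w] and remainder [l]; [step x] is then left multiplication by [x]. *)
Definition step x (p : W * seq S) : W * seq S :=
  let h := hd x p.1 in (x * h, canon (rw (h^-1 * p.1) ++ p.2)).

(** Let [a], [b], [c] be the prefixes moved by [x * y], by [y], and then by [x]. Maximality of [b]
    and [c] gives [wle (y * a) c]; conversely [c = y * d] with [d] admissible for [a]. Hence
    [c = y * a]. *)
Lemma step_mul x y p : red x y -> step x (step y p) = step (x * y) p.
Proof.
case: p => w l rxy; rewrite /step /=.
have [aw ra amax] := hdP (x * y) w; have [bw rb bmax] := hdP y w.
have [cw rc cmax] := hdP x (y * hd y w).
move: (hd (x * y) w) (hd y w) (hd x _) => a b c in aw ra amax bw rb bmax cw rc cmax *.
have lxya := wlen_mul x (y * a); have lya := wlen_mul y a.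
have rya : red y a.
  by move: rxy ra; rewrite /red -mulgA => /eqP E1 /eqP E2; apply/eqP; clear -E1 E2 lxya lya; glia (coxeter M).
have rxya : red x (y * a).
  by move: rxy ra; rewrite /red -mulgA => /eqP E1 /eqP E2; apply/eqP; clear -E1 E2 lxya lya; glia (coxeter M).
have ab : wle a b by apply: bmax.
have yac : wle (y * a) c by apply: cmax => //; case/andP: (wle_mul2 rb ab).
have yc : wle y c by apply: cmax; rewrite ?wle_mul.
have [d cE] : exists d, c = y * d by exists (y^-1 * c); rewrite mulVKg.
have ryd : red y d by rewrite -wle_mul -cE.
have db : wle d b by move: cw; rewrite cE => /(wle_mull ryd)/andP[_]; rewrite mulKg.
have rd : red (x * y) d.
  move: rxy ryd rc; rewrite cE /red -mulgA => /eqP E1 /eqP E2 /eqP E3.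
  by apply/eqP; clear -E1 E2 E3; glia (coxeter M).
have da : wle d a by apply: amax rd; apply: wle_trans bw.
have ca : c = y * a.
  by apply: wle_anti => //; rewrite cE; case/andP: (wle_mul2 rya da).
rewrite ca mulgA; congr (_, _); apply: canon_eq.
rewrite invgM -mulgA mulKg canonP catA.
rewrite -rw_mul; first by rewrite mulgA mulgK.
move: ab bw aw; rewrite /wle /red => /eqP E1 /eqP E2 /eqP E3.
by apply/eqP; rewrite mulgA mulgK; clear -E1 E2 E3; glia (coxeter M).
Qed.

Definition fold_step u p := foldr (fun s => step (sg s)) p u.

(** The empty word is excluded because [step 1] replaces the remainder by its canonical
    representative. *)
Lemma fold_step_reduced u p : reduced M u -> u != [::] -> fold_step u p = step (wd u) p.
Proof.
elim: u => [//|s u IHu] rsu _; have := rsu; rewrite reduced_cons => /andP[ru _] /=.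
have [->|u0] := eqVneq u [::]; first by [].
rewrite [fold_step u p]IHu // step_mul -?wd_cons //.
move: rsu ru; rewrite /reduced /red wd_cons /= => /eqP E1 /eqP E2.
by apply/eqP; have := wlen_sg M s; glia (coxeter M).
Qed.

(** The two sides of a braid relation are reduced words of one element, so [fold_step_reduced] makes
    them act alike. *)
Lemma fold_step_pcong u v p : pcong u v -> fold_step u p = fold_step v p.
Proof.
move=> uv; elim: uv p => {u v} [//|u v _ IH p|u v w _ IH1 _ IH2 p|u u' v v' _ IH1 _ IH2 p|].
- by rewrite IH.
- by rewrite IH1 IH2.
- by rewrite /fold_step !foldr_cat -!/(fold_step _ _) IH2 IH1.
move=> s t k st Mst p; have k2 := cox_offdiag st Mst.
have ts : t != s by rewrite eq_sym.
have Mts : M t s = Some k by rewrite cox_sym.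
rewrite !fold_step_reduced ?(wd_alt st Mst) //.
- exact: alt_reduced.
- by rewrite -size_eq0 size_alt; lia.
- exact: alt_reduced.
- by rewrite -size_eq0 size_alt; lia.
Qed.

Definition nform u := fold_step u (1, canon [::]).

Lemma nformP u : pcong u (rw (nform u).1 ++ (nform u).2).
Proof.
elim: u => [|s u IHu] /=.
  have := rw_pcong (u := [::]); rewrite wd_nil => -> //.
    by rewrite canonP.
  by rewrite /reduced wd_nil wlen1.
rewrite -/(nform u) canonP; have [hw rs _] := hdP (sg s) (nform u).1.
rewrite rw_mul // rw_sg -catA (catA (rw (hd _ _))) -rw_mul.
  by rewrite mulVKg -IHu.
by rewrite -wle_mul mulVKg.
Qed.

Lemma nform_eq u v : pcong u v -> nform u = nform v.
Proof. exact: fold_step_pcong. Qed.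

(** Left cancellation: the normal form of [s :: u] determines the prefix moved by [sg s] and the
    class of what remains, and these two recompose [u]. *)
Lemma pcong_cons_inv s u v : pcong (s :: u) (s :: v) -> pcong u v.
Proof.
move=> /nform_eq; rewrite /nform /= -!/(nform _) => -[/mulgI Eh /canon_inj E].
have [hu _ _] := hdP (sg s) (nform u).1; have [hv _ _] := hdP (sg s) (nform v).1.
rewrite (nformP u) (nformP v).
rewrite -[(nform u).1](mulVKg (hd (sg s) (nform u).1)) rw_mul; last first.
  by rewrite -wle_mul mulVKg.
rewrite -catA E Eh catA -rw_mul; last by rewrite -wle_mul mulVKg.
by rewrite mulVKg.
Qed.

Lemma pcong_cat_invl (w : seq S) u v : pcong (w ++ u) (w ++ v) -> pcong u v.
Proof. by elim: w => // s w IHw /pcong_cons_inv. Qed.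

Lemma pcong_cat_invr (w : seq S) u v : pcong (u ++ w) (v ++ w) -> pcong u v.
Proof.
move=> /pcong_rev; rewrite !rev_cat => /pcong_cat_invl/pcong_rev.
by rewrite !revK.
Qed.

Lemma nform_des u s v : pcong u (s :: v) -> ldes s (nform u).1.
Proof.
move=> /nform_eq ->; rewrite /nform /= -/(nform v).
by have [_ r _] := hdP (sg s) (nform v).1; rewrite -wle_sg wle_mul.
Qed.

(** The Garside element of the submonoid generated by [P], as a lift of the longest element. *)
Definition dword P := rw (longest P).

Lemma all_rw P w : in_para P w -> all P (rw w).
Proof.
move=> /in_para_reduced[u [Pu ru <-]].
by rewrite (pcong_all _ (rw_pcong ru)).
Qed.

Lemma all_dword P : all P (dword P).
Proof. by apply: all_rw; case: (longestP Mspherical P). Qed.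

Lemma dword_consE P s : P s -> pcong (dword P) (s :: rw (sg s * longest P)).
Proof.
move=> Ps; have [lP dl] := longestP Mspherical P.
rewrite /dword -{1}[longest P](sgKl s) rw_mul; first by rewrite rw_sg /=.
by rewrite -wle_mul sgKl wle_sg dl.
Qed.

Lemma dword_cons P s : P s -> exists2 v, all P v & pcong (dword P) (s :: v).
Proof.
move=> Ps; exists (rw (sg s * longest P)); last exact: dword_consE.
have [lP _] := longestP Mspherical P.
by apply: all_rw; apply: in_paraM => //; apply: in_para_sg.
Qed.

Lemma dword_swap P s t : P s -> sg s * longest P = longest P * sg t ->
  pcong (s :: dword P) (dword P ++ [:: t]).
Proof.
move=> Ps E; have [lP dl] := longestP Mspherical P.
have E1 : pcong (dword P) (rw (sg s * longest P) ++ [:: t]).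
  rewrite /dword -{1}[longest P](sgKr t) -E rw_mul; first by rewrite rw_sg /=.
  rewrite /red E sgKr -E wlen_sg addn1.
  by apply/eqP/wlen_sg_des/dl.
rewrite {1}E1 -cat_cons; apply: pcong_catr.
by apply: PcongSym; apply: dword_consE.
Qed.

Lemma dword_conj P s : P s -> exists t, [/\ P t,
  pcong (s :: dword P) (dword P ++ [:: t]) & pcong (t :: dword P) (dword P ++ [:: s])].
Proof.
move=> Ps; have [t [Pt E1 E2]] := longest_conj Mspherical Ps.
by exists t; split=> //; apply: dword_swap.
Qed.

(** Every letter of [P] is a descent of the greatest reduced prefix of [u], so [longest P] is a
    prefix of it. *)
Lemma dword_lcm P u : (forall s, P s -> exists v, pcong u (s :: v)) ->
  exists v, pcong u (dword P ++ v).
Proof.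
move=> Pu; have dP s : P s -> ldes s (nform u).1.
  by move=> /Pu[v /nform_des].
have le := longest_le Mspherical dP.
exists (rw ((longest P)^-1 * (nform u).1) ++ (nform u).2).
rewrite catA /dword -rw_mul; last by rewrite -wle_mul mulVKg.
by rewrite mulVKg; apply: nformP.
Qed.

Lemma dword_squarefree P u s v : ~ pcong (dword P) (u ++ s :: s :: v).
Proof.
move=> E; have := pcong_size E; rewrite size_rw size_cat /=.
have := pcong_wd E; have [_ ->] := rwP (longest P).
rewrite wd_cat !wd_cons sgKl -wd_cat => ->.
by have := wlen_le M (u ++ v); rewrite size_cat; lia.
Qed.

(** * The positive monoid embeds in the group *)

Definition garside_sq := dword predT ++ dword predT.

(** Moving a letter through one copy of [dword predT] permutes the generators by an involution, so
    two copies restore it. *)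
Lemma garside_sq_central u : pcong (u ++ garside_sq) (garside_sq ++ u).
Proof.
elim: u => [|s u IHu]; first by rewrite cats0.
rewrite cat_cons IHu -cat_cons -[s :: u]cat1s catA; apply: pcong_catr.
have [t [_ E1 E2]] := dword_conj (P := predT) (s := s) isT.
by rewrite /garside_sq -cat_cons E1 -catA /= E2 catA.
Qed.

Definition gpow n := flatten (nseq n garside_sq).

Lemma gpowD m n : gpow (m + n) = gpow m ++ gpow n.
Proof. by rewrite /gpow nseqD flatten_cat. Qed.

Lemma gpowC m n : gpow m ++ gpow n = gpow n ++ gpow m.
Proof. by rewrite -!gpowD addnC. Qed.

Lemma gpow_central n u : pcong (u ++ gpow n) (gpow n ++ u).
Proof.
elim: n => [|n IHn]; first by rewrite cats0.
by rewrite /gpow /= -/(gpow n) catA garside_sq_central -catA IHn catA.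
Qed.

(** A negative letter [s^-1] becomes a positive word for [s^-1] times the central square. *)
Definition letter (l : S * bool) : seq S :=
  if l.2 then [:: l.1] else rw (sg l.1 * w0) ++ dword predT.

Definition clear_word (p : word S) : seq S := flatten [seq letter l | l <- p].

Definition negs (p : word S) : nat := count (fun l => ~~ l.2) p.

Lemma letter_mul s : pcong (s :: letter (s, false)) garside_sq /\
  pcong (letter (s, false) ++ [:: s]) garside_sq.
Proof.
have E : pcong (s :: letter (s, false)) garside_sq.
  by rewrite /letter /= -cat_cons -dword_consE.
split=> //; apply: (@pcong_cons_inv s); rewrite -cat_cons E.
by rewrite -garside_sq_central.
Qed.

Lemma clear_word_pos u : clear_word [seq (s, true) | s <- u] = u /\
  negs [seq (s, true) | s <- u] = 0.
Proof.
by elim: u => [|s u [IH1 IH2]] //; rewrite /clear_word /negs /= -/(clear_word _) IH1 -/(negs _) IH2.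
Qed.

(* Multiplying by a power of the central element [garside_sq] clears the
   negative letters of [p] and [q]. *)
Lemma clear_word_pcong p q : pres_cong (artin_rel M) p q ->
  pcong (clear_word p ++ gpow (negs q)) (clear_word q ++ gpow (negs p)).
Proof.
elim=> {p q} [//|p q _ E|p q r _ E1 _ E2|p p' q q' _ E1 _ E2|s b|p q [s [t [k [st Mst -> ->]]]]].
- exact: PcongSym.
- apply: (@pcong_cat_invr (gpow (negs q))).
  by rewrite -catA gpowC catA E1 -catA gpowC catA E2 -catA gpowC catA.
- rewrite /clear_word /negs !map_cat !flatten_cat !count_cat !gpowD.
  rewrite -/(clear_word p) -/(clear_word q) -/(clear_word p') -/(clear_word q').
  rewrite -/(negs p) -/(negs q) -/(negs p') -/(negs q').
  rewrite -catA (catA (clear_word q)) (gpow_central (negs p') (clear_word q)) -catA E2 catA E1.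
  by rewrite -catA (catA (gpow _)) -(gpow_central (negs p) (clear_word q')) -!catA.
- have [E1 E2] := letter_mul s.
  have G1 : gpow 1 = garside_sq by rewrite /gpow /= cats0.
  have C (b' : bool) : clear_word [:: (s, b'); (s, ~~ b')] = letter (s, b') ++ letter (s, ~~ b').
    by rewrite /clear_word /= cats0.
  rewrite C [negs [::]]/= [gpow 0]/= cats0 [clear_word [::]]/= cat0s.
  by case: b {C}; rewrite [negs _]/= G1.
- have H (a b : S) : clear_word (alt_word a b k) = alt a b k /\ negs (alt_word a b k) = 0.
    rewrite (_ : alt_word a b k = [seq (r, true) | r <- alt a b k]).
      exact: clear_word_pos.
    by rewrite /alt /mkseq -map_comp.
  have [-> ->] := H s t; have [-> ->] := H t s.
  by rewrite !cats0; apply: PcongAlt.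
Qed.

Definition pos_word u : artin M := \pi_(pres_group (artin_rel M)) [seq (s, true) | s <- u].

(** Positive words have no negative letter to clear, so [clear_word_pcong] is already the wanted
    congruence. *)
Lemma pos_inj u v : pos_word u = pos_word v -> pcong u v.
Proof.
move=> /pres_piP /clear_word_pcong.
have [-> ->] := clear_word_pos u; have [-> ->] := clear_word_pos v.
by rewrite !cats0.
Qed.

Lemma pos_pcong u v : pcong u v -> pos_word u = pos_word v.
Proof.
move=> uv; apply/pres_piP.
elim: uv => {u v} [u|u v _ E|u v z _ E1 _ E2|u u' v v' _ E1 _ E2|s t k st Mst].
- exact: PresRefl.
- exact: PresSym.
- exact: PresTrans E1 E2.
- by rewrite !map_cat; apply: PresCat.
- apply: PresRel; exists s, t, k.
  by split=> //; rewrite /alt_word /alt /mkseq -map_comp.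
Qed.
End Monoid.

(** * Positive elements of the Artin-Tits group and their divisors *)

Section Garside.
Context {S : finType} (M : cox_matrix S).
Hypothesis Mspherical : spherical M.
Local Notation A := (artin M).
Local Notation pos := (pos_word M).
Local Notation gen := (gen M).
Implicit Types (s t : S) (u v w : seq S) (a b c d e x y z : A) (P Y : pred S).

Lemma pos_cat u v : pos (u ++ v) = pos u * pos v.
Proof. by rewrite /pos_word map_cat -pres_mulE. Qed.

Lemma pos_nil : pos [::] = 1. Proof. by []. Qed.

Lemma pos_cons s u : pos (s :: u) = gen s * pos u.
Proof. by rewrite -cat1s pos_cat. Qed.

Lemma pos_nseq n s : pos (nseq n s) = gen s ^+ n.
Proof. by elim: n => // n IHn; rewrite [nseq _ _]/= pos_cons IHn expgS. Qed.

Lemma pos_size u v : pos u = pos v -> size u = size v.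
Proof. by move=> /(pos_inj Mspherical)/pcong_size. Qed.

Definition psize a : nat := size (xget [::] [set u | pos u = a]%classic).

Lemma psize_pos u : psize (pos u) = size u.
Proof.
apply: pos_size; apply: (@xgetPex _ [::] [set v | pos v = pos u]%classic).
by exists u.
Qed.

Lemma pos_all P u v : pos u = pos v -> all P u = all P v.
Proof. by move=> /(pos_inj Mspherical)/pcong_all. Qed.

Definition posin P a := exists2 u, all P u & a = pos u.
Local Notation positive := (posin predT).

Lemma positive_pos u : positive (pos u).
Proof. by exists u => //; apply/allP. Qed.

Lemma posin_positive P a : posin P a -> positive a.
Proof. by case=> u _ ->; apply: positive_pos. Qed.

Lemma posin_sub P Y a : subpred P Y -> posin P a -> posin Y a.
Proof. by move=> PY [u Pu ->]; exists u => //; apply: sub_all Pu. Qed.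

Lemma posinE P u : posin P (pos u) <-> all P u.
Proof. by split=> [[v Pv /pos_all->]//|Pu]; exists u. Qed.

Lemma posin1 P : posin P 1.
Proof. by exists [::]. Qed.

Lemma posin_gen P s : P s -> posin P (gen s).
Proof. by move=> Ps; exists [:: s]; rewrite //= Ps. Qed.

Lemma posinM P a b : posin P a -> posin P b -> posin P (a * b).
Proof. by move=> [u Pu ->] [v Pv ->]; exists (u ++ v); rewrite ?all_cat ?Pu ?pos_cat. Qed.

Lemma posinX P a n : posin P a -> posin P (a ^+ n).
Proof.
move=> Pa; elim: n => [|n IHn]; first exact: posin1.
by rewrite expgS; apply: posinM.
Qed.

(** Congruent positive words have the same support, so parabolic submonoids are closed under
    factors. *)
Lemma posin_split P a b : positive a -> positive b -> posin P (a * b) ->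
  posin P a /\ posin P b.
Proof.
move=> [u _ ->] [v _ ->]; rewrite -pos_cat => /posinE.
by rewrite all_cat => /andP[Pu Pv]; split; apply/posinE.
Qed.

Lemma posin_pow s a : posin (pred1 s) a -> exists n, a = gen s ^+ n.
Proof.
move=> [u /all_pred1P us ->]; exists (size u).
by rewrite us pos_nseq size_nseq.
Qed.

Lemma artin_posE a : artin_pos a <-> positive a.
Proof.
split=> [Ha|[u _ ->]]; last first.
  move=> H [[H1 HM] Hg]; elim: u => [|s u IHu]; first exact: H1.
  by rewrite pos_cons; apply: HM => //; apply: Hg; exists s.
apply: (Ha positive); split; last by move=> _ [s _ <-]; apply: posin_gen.
by split=> [|x y]; [apply: posin1|apply: posinM].
Qed.

(** * Divisibility *)

Definition dv a b := positive (a^-1 * b).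

Lemma precE a b : prec a b <-> dv a b.
Proof. exact: artin_posE. Qed.

Lemma dvP a b : dv a b <-> exists2 c, positive c & b = a * c.
Proof.
split=> [p|[c pc ->]]; last by rewrite /dv mulKg.
by exists (a^-1 * b) => //; rewrite mulVKg.
Qed.

Lemma dv_refl a : dv a a.
Proof. by rewrite /dv mulVg; apply: posin1. Qed.

Lemma dv_trans b a c : dv a b -> dv b c -> dv a c.
Proof. by move=> ab bc; have := posinM ab bc; rewrite /dv mulgA mulgK. Qed.

Lemma dv_mulr a b : positive b -> dv a (a * b).
Proof. by rewrite /dv mulKg. Qed.

Lemma dv1 a : dv 1 a <-> positive a.
Proof. by rewrite /dv invg1 mul1g. Qed.

Lemma dv_mull c a b : dv (c * a) (c * b) <-> dv a b.
Proof. by rewrite /dv invgM -!mulgA mulKg. Qed.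

Lemma psizeM a b : positive a -> positive b -> psize (a * b) = psize a + psize b.
Proof. by move=> [u _ ->] [v _ ->]; rewrite -pos_cat !psize_pos size_cat. Qed.

Lemma psize_gen s : psize (gen s) = 1%N.
Proof. exact: (psize_pos [:: s]). Qed.

Lemma psize_dv a b : positive a -> dv a b -> psize a <= psize b.
Proof. by move=> pa /dvP[c pc ->]; rewrite psizeM // leq_addr. Qed.

Lemma dv_positive a b : positive a -> dv a b -> positive b.
Proof. by move=> pa /dvP[c pc ->]; apply: posinM. Qed.

Lemma positive_eq1 a b : positive a -> positive b -> a * b = 1 -> a = 1.
Proof.
move=> [u _ ->] [v _ ->]; rewrite -pos_cat -pos_nil => /pos_size.
by case: u.
Qed.

Lemma dv_anti a b : dv a b -> dv b a -> a = b.
Proof.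
move=> ab ba; have E : a^-1 * b = 1.
  by apply: (positive_eq1 ab ba); rewrite mulgA mulgK mulVg.
by rewrite -[b](mulVKg a) E mulg1.
Qed.

Lemma dv_gen a t : positive a -> dv a (gen t) -> a = 1 \/ a = gen t.
Proof.
move=> [u _ ->] /dvP[_ [v _ ->]]; rewrite -pos_cat => E.
have {}E : pos [:: t] = pos (u ++ v) by exact: E.
have := pos_size E; have := pos_all (pred1 t) E; rewrite /= eqxx size_cat all_cat.
move=> /esym/andP[ut _].
case: u ut {E} => [|s [|r u]] //=; first by left.
by rewrite andbT => /eqP -> _; right.
Qed.

Lemma gen_neq1 s : gen s <> 1.
Proof. by move/(@pos_size [:: s] [::]). Qed.

Lemma not_dv_gen1 s : ~ dv (gen s) 1.
Proof.
move=> /dvP[c pc E]; apply: (@gen_neq1 s).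
exact: (positive_eq1 (@posin_gen predT s isT) pc (esym E)).
Qed.

(** * Garside elements of standard parabolic subgroups *)

Definition para_delta P : A := pos (dword M P).
Local Notation D := para_delta.
Local Notation Dl := (D predT).

Lemma posin_D P : posin P (D P).
Proof. by apply/posinE/all_dword. Qed.

Lemma positive_D P : positive (D P).
Proof. exact: posin_positive (posin_D P). Qed.

Lemma D_dv P a : positive a -> (forall s, P s -> dv (gen s) a) -> dv (D P) a.
Proof.
move=> [u _ ->] Pu; have [|v uv] := @dword_lcm _ _ Mspherical P u.
  move=> s /Pu/dvP[_ [v _ ->] E]; exists v; apply: pos_inj => //.
  by rewrite pos_cons.
by apply/dvP; exists (pos v); [apply: positive_pos|rewrite -pos_cat (pos_pcong uv)].
Qed.

Lemma gen_dv_D P s : P s -> exists2 c, posin P c & D P = gen s * c.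
Proof.
move=> /(dword_cons Mspherical)[v Pv E]; exists (pos v); first exact/posinE.
by rewrite -pos_cons /para_delta (pos_pcong E).
Qed.

Lemma D_gen P s : P s -> exists t,
  [/\ P t, gen s * D P = D P * gen t & gen t * D P = D P * gen s].
Proof.
move=> /(dword_conj Mspherical)[t [Pt /pos_pcong E1 /pos_pcong E2]].
by exists t; split=> //; move: E1 E2; rewrite !pos_cat !pos_cons pos_nil !mulg1.
Qed.

Lemma D_pred1 s : D (pred1 s) = gen s.
Proof.
apply: dv_anti.
  by apply: D_dv => [|t /eqP->]; [apply: posin_gen|apply: dv_refl].
have [|c pc ->] := @gen_dv_D (pred1 s) s; first by rewrite /= eqxx.
exact/dv_mulr/(posin_positive pc).
Qed.

Lemma posin_conj P a : posin P a -> exists b,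
  [/\ posin P b, a * D P = D P * b & b * D P = D P * a].
Proof.
case=> u + ->; elim: u => [|s u IHu] /=.
  by exists 1; rewrite pos_nil mulg1 mul1g; split=> //; apply: posin1.
case/andP=> /D_gen[t [Pt st ts]] /IHu[b [Pb ub bu]]; exists (gen t * b).
split; first by apply: posinM => //; apply: posin_gen.
  by rewrite pos_cons -mulgA ub !mulgA st.
by rewrite pos_cons -mulgA bu !mulgA ts.
Qed.

Lemma posin_conjD P a : posin P a -> posin P (a ^ D P) /\ posin P (a ^ (D P)^-1).
Proof.
move=> /posin_conj[b [Pb ab ba]]; rewrite !conjgE invgK ab mulKg.
by rewrite mulgA -ba mulgK.
Qed.

Lemma posin_conjX P n a : posin P a ->
  posin P (a ^ (D P ^+ n)) /\ posin P (a ^ (D P ^- n)).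
Proof.
elim: n a => [|n IHn] a Pa; first by rewrite expg0 invg1 conjg1.
have [Pb _] := posin_conjD Pa; have [_ Pc] := IHn a Pa.
have [Pd _] := IHn _ Pb; have [_ Pe] := posin_conjD Pc.
by rewrite expgS invgM !conjgM.
Qed.

Lemma DD_comm P a : posin P a -> a * (D P * D P) = D P * D P * a.
Proof. by move=> /posin_conj[b [_ ab ba]]; rewrite mulgA ab -!mulgA ba. Qed.

Lemma D_even_comm P a n : posin P a -> commute a (D P ^+ n.*2).
Proof.
move=> Pa; rewrite -mul2n expgnA; apply: commuteX.
by rewrite expg2; apply: DD_comm.
Qed.

(** Each letter [s] uses one factor [D P = gen s * d], and [d] is carried past the remaining power
    by conjugation, which preserves the submonoid. *)
Lemma posin_dv_DX P a : posin P a -> exists n, forall m, n <= m ->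
  exists2 c, posin P c & D P ^+ m = a * c.
Proof.
move=> Pa; suff [n [c [Pc E]]] : exists n c, posin P c /\ D P ^+ n = a * c.
  exists n => m nm; exists (c * D P ^+ (m - n)); last first.
    by rewrite mulgA -E -expgnDr subnKC.
  by apply: posinM => //; apply/posinX/posin_D.
case: Pa => u + ->; elim: u => [|s u IHu] /=.
  by exists 0, 1; rewrite expg0 pos_nil mulg1; split=> //; apply: posin1.
case/andP=> Ps /IHu[n [c [Pc E]]]; have [d Pd Dd] := gen_dv_D Ps.
exists n.+1, (c * (d ^ (D P ^+ n))); split.
  by apply: posinM => //; case: (posin_conjX n Pd).
rewrite expgS {1}Dd pos_cons conjgE -[gen s * pos u * _]mulgA [pos u * _]mulgA -E.
by rewrite mulVKg mulgA.
Qed.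

(* The least common multiple is the largest common divisor of all the common
   multiples. *)
Lemma lcm_exists a b : positive a -> positive b -> exists l,
  [/\ positive l, dv a l, dv b l & forall c, dv a c -> dv b c -> dv l c].
Proof.
move=> pa pb.
have [na /(_ (na + _) (leq_addr _ _)) Na] := posin_dv_DX pa.
have [nb /(_ (_ + nb) (leq_addl _ _)) Nb] := posin_dv_DX pb.
have [ca pca Eca] := Na nb; have [cb pcb Ecb] := Nb na.
(* The divisors of all common multiples are bounded in length, since a power of [Dl] is a common
   multiple. *)
pose E x := positive x /\ forall c, dv a c -> dv b c -> dv x c.
have [||||||||l [[pl El] lP]] := @confluent_max A dv
    (fun x y => positive x /\ exists s, y = x * gen s) psize E
    (psize (Dl ^+ (na + nb))) 1.
- exact: dv_refl.
- by move=> x y z; apply: dv_trans.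
- move=> x _ [px [s ->]]; have ps := @posin_gen predT s isT.
  by split; [apply: dv_mulr|rewrite psizeM // psize_gen addn1].
- move=> x y [px Ex] [py Ey] /dvP[_ [[|s u] _ ->] yE].
    by left; rewrite yE pos_nil mulg1.
  have xsy : dv (x * gen s) y.
    by rewrite yE pos_cons mulgA; apply/dv_mulr/positive_pos.
  right; exists (x * gen s); split=> //; first by split=> //; exists s.
  split; first by apply: posinM => //; apply: posin_gen.
  by move=> c ac bc; apply: dv_trans xsy (Ey _ ac bc).
- move=> x [px Ex]; apply: psize_dv => //; apply: Ex.
    by rewrite Eca; apply: dv_mulr.
  by rewrite Ecb; apply: dv_mulr.
- move=> x y z [px _] [_ Ey] [_ Ez] [_ [s yE]] [_ [t zE]].
  (* Two extensions of [x] by [s] and [t] are joined by the Garside element of these two letters. *)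
  exists (x * D (pred2 s t)); rewrite yE zE.
  split; last 2 first.
  + by apply/dv_mull; have [|c pc ->] := @gen_dv_D (pred2 s t) s;
      rewrite /= ?eqxx //; apply/dv_mulr/(posin_positive pc).
  + by apply/dv_mull; have [|c pc ->] := @gen_dv_D (pred2 s t) t;
      rewrite /= ?eqxx ?orbT //; apply/dv_mulr/(posin_positive pc).
  split; first by apply: posinM => //; apply: positive_D.
  move=> c ac bc; have xc : dv x c.
    apply: dv_trans (Ey _ ac bc); rewrite yE; exact/dv_mulr/posin_gen.
  rewrite -[c](mulVKg x); apply/dv_mull/D_dv => // q /pred2P[]->.
    by apply/(@dv_mull x); rewrite mulVKg -yE; apply: Ey.
  by apply/(@dv_mull x); rewrite mulVKg -zE; apply: Ez.
- by split; [apply: posin1|move=> c ac _; apply/dv1/(dv_positive pa ac)].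
- by move=> x [px _]; apply/dv1.
exists l; split=> //; apply: lP; split=> //.
Qed.

(** * Ribbons *)

(* The least common multiple of [gen s] and [d] properly extends [d] and divides
   [gen s * d = d * gen t], so it is [d * gen t]. *)
Lemma ribbon_dv s t d x : positive d -> positive x -> gen s * d = d * gen t ->
  ~ dv (gen s) d -> dv (gen s) (d * x) -> dv (gen t) x.
Proof.
move=> [v _ ->] pu E nsd sdu.
have [l [pl sl dl lP]] := lcm_exists (@posin_gen predT s isT) (positive_pos v).
have /dvP[e pe lE] := dl.
have := lP _ (dv_mulr _ (positive_pos v)); rewrite E => /(_ (dv_mulr _ _)).
rewrite {1}lE => /(_ (@posin_gen predT t isT))/dv_mull/(dv_gen pe)[e1|eE].
  by case: nsd; rewrite lE e1 mulg1 in sl.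
by have := lP _ sdu (dv_mulr _ pu); rewrite lE eE => /dv_mull.
Qed.

Definition pred_reduced P d := forall s, P s -> ~ dv (gen s) d.

(** The least common multiple of [a] and [b] divides a power of [D P], so it is [b * e] with [e] in
    the submonoid of [P]. It divides [b * d], so [e] divides [d], which forces [e = 1]. *)
Lemma reduced_dv P a b d : posin P a -> posin P b -> positive d ->
  pred_reduced P d -> dv a (b * d) -> dv a b.
Proof.
move=> Pa Pb pd rd abd; have pa := posin_positive Pa; have pb := posin_positive Pb.
have [l [pl al bl lP]] := lcm_exists pa pb.
have [na /(_ (na + _) (leq_addr _ _)) Na] := posin_dv_DX Pa.
have [nb /(_ (_ + nb) (leq_addl _ _)) Nb] := posin_dv_DX Pb.
have [ca pca Eca] := Na nb; have [cb pcb Ecb] := Nb na.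
have /dvP[f pf lf] : dv l (D P ^+ (na + nb)).
  by apply: lP; [rewrite Eca|rewrite Ecb]; apply/dv_mulr/posin_positive; eassumption.
have [|Pl _] := @posin_split P l f pl pf.
  by rewrite -lf; apply/posinX/posin_D.
have /dvP[e pe lE] := bl; move: Pl; rewrite lE => /(posin_split pb pe)[_ [u Pu eE]].
have := lP _ abd (dv_mulr _ pd); rewrite lE => /dv_mull.
case: u eE Pu => [eE _ _|s u eE /andP[Ps _]].
  by move: al; rewrite lE eE pos_nil mulg1.
rewrite eE pos_cons => sud; case: (rd s Ps); apply: dv_trans sud.
exact/dv_mulr/positive_pos.
Qed.

Lemma D_squarefree P a s b : positive a -> positive b -> D P <> a * gen s * gen s * b.
Proof.
move=> [u _ ->] [v _ ->] E; apply: (@dword_squarefree _ M P u s v).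
by apply: pos_inj => //; rewrite pos_cat !pos_cons !mulgA.
Qed.

Lemma D_sub P Y : subpred P Y -> dv (D P) (D Y).
Proof.
move=> PY; apply: D_dv => [|s /PY/gen_dv_D[c Yc ->]]; first exact: positive_D.
exact/dv_mulr/(posin_positive Yc).
Qed.

Lemma Dl_gen s : exists t, gen s * Dl = Dl * gen t /\ gen t * Dl = Dl * gen s.
Proof. by have [t [_ ? ?]] := @D_gen predT s isT; exists t. Qed.

Lemma dv_conjD a b : dv a b <-> dv (a ^ Dl) (b ^ Dl).
Proof.
rewrite /dv -conjVg -conjMg; split=> [/posin_conjD[]//|/posin_conjD[_]].
by rewrite conjgK.
Qed.

Definition compl Y n : A := D Y ^- n * Dl ^+ n.

Lemma complE Y n : Dl ^+ n = D Y ^+ n * compl Y n.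
Proof. by rewrite mulVKg. Qed.

Lemma compl1 Y : compl Y 1 = (D Y)^-1 * Dl.
Proof. by []. Qed.

Lemma complS Y n : compl Y n.+1 = compl Y 1 * compl Y n ^ Dl.
Proof.
by rewrite compl1 /compl conjgE !expgSr invgM !mulgA mulgK.
Qed.

Lemma positive_compl1 Y : positive (compl Y 1).
Proof. exact: D_sub. Qed.

Lemma positive_compl Y n : positive (compl Y n).
Proof.
elim: n => [|n IHn]; first by rewrite /compl !expg0 invg1 mulg1; apply: posin1.
by rewrite complS; apply: posinM (positive_compl1 Y) _; case: (posin_conjD IHn).
Qed.

(** Conjugation by [D Y] and then by [Dl] permutes generators, which gives the ribbon. As [D Y] ends
    with [gen s], a left divisor [gen s] of the complement would put a square inside [Dl]. *)
Lemma compl1_gen Y s : Y s -> exists s1 s2, [/\ Y s1,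
  gen s * compl Y 1 = compl Y 1 * gen s2, gen s1 ^ Dl = gen s2 & ~ dv (gen s) (compl Y 1)].
Proof.
move=> Ys; have [s1 [Ys1 E1 E2]] := D_gen Ys; have [s2 [E3 E4]] := Dl_gen s1.
exists s1, s2; split=> //.
- have -> : gen s = (D Y)^-1 * gen s1 * D Y by rewrite -mulgA E2 mulKg.
  by rewrite compl1 !mulgA mulgK -!mulgA E3.
- by rewrite conjgE E3 mulKg.
- move=> /dvP[v pv E]; have [c Yc Dc] := gen_dv_D Ys1.
  have cs : D Y = c * gen s.
    by apply: (mulgI (gen s1)); rewrite E2 mulgA -Dc.
  apply: (@D_squarefree predT c s v) => //; first exact: posin_positive Yc.
  by rewrite -cs -mulgA -E -(complE Y 1) expg1.
Qed.

(** By [complS] and [ribbon_dv], a divisor [gen s] of [compl Y n.+1] passes through [compl Y 1];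
    undoing the conjugation by [Dl] gives a divisor of [compl Y n] in [Y]. *)
Lemma compl_reduced Y n : pred_reduced Y (compl Y n).
Proof.
elim: n => [|n IHn] s Ys.
  by rewrite /compl !expg0 invg1 mulg1; apply: not_dv_gen1.
have [s1 [s2 [Ys1 E12 E2 nE]]] := compl1_gen Ys.
rewrite complS => /(ribbon_dv (positive_compl1 Y) _ E12 nE) H.
apply: (IHn s1 Ys1); apply/dv_conjD; rewrite E2; apply: H.
by case: (posin_conjD (positive_compl Y n)).
Qed.

Lemma posin_dv_Dl Y c n : posin Y c -> dv c (Dl ^+ n) -> dv c (D Y ^+ n).
Proof.
move=> Yc; rewrite (complE Y).
apply: reduced_dv (positive_compl Y n) (@compl_reduced Y n) => //.
exact/posinX/posin_D.
Qed.

Lemma gen_pow_dv_Dl s n : ~ dv (gen s ^+ n.+1) (Dl ^+ n).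
Proof.
move=> sD; have Ps : posin (pred1 s) (gen s ^+ n.+1).
  by apply/posinX/posin_gen; rewrite /= eqxx.
have := psize_dv (posin_positive Ps) (posin_dv_Dl Ps sD).
by rewrite D_pred1 -!pos_nseq !psize_pos !size_nseq ltnn.
Qed.

End Garside.

(** * Integer powers in a group *)

Section IntegerPowers.
Context {G : groupType}.
Implicit Types (x y : G) (p q : int).
Local Open Scope ring_scope.

Lemma expgz_succ x p : expgz x (p + 1) = (expgz x p * x)%g.
Proof.
case: p => [n|[|n]]; first by rewrite -PoszD addn1 /= expgSr.
  by rewrite /= mulVg.
have -> : Negz n.+1 + 1 = Negz n by rewrite !NegzE; lia.
by rewrite /= [in RHS]expgS invgM mulgVK.
Qed.

Lemma expgzD x p q : expgz x (p + q) = (expgz x p * expgz x q)%g.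
Proof.
have Hn r (n : nat) : expgz x (r + n%:Z) = (expgz x r * x ^+ n)%g.
  elim: n => [|n IHn]; first by rewrite addr0 mulg1.
  by rewrite -addn1 PoszD addrA expgz_succ IHn -mulgA addn1 expgSr.
case: q => n; first exact: Hn.
have := Hn (p + Negz n) n.+1; rewrite NegzE addrNK => ->.
by rewrite -NegzE /= mulgK.
Qed.

Lemma expgzN x p : expgz x (- p) = (expgz x p)^-1%g.
Proof. by apply: (mulIg (expgz x p)); rewrite -expgzD addNr mulVg. Qed.

Lemma expgzM x p q : expgz x (p * q) = expgz (expgz x p) q.
Proof.
have Hn (n : nat) : expgz x (p * n%:Z) = (expgz x p ^+ n)%g.
  elim: n => [|n IHn]; first by rewrite mulr0.
  by rewrite -addn1 PoszD mulrDr mulr1 expgzD IHn addn1 expgSr.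
by case: q => n; rewrite ?NegzE ?mulrN ?expgzN Hn // -NegzE.
Qed.

Lemma expgz_conjxx x p q : (expgz x p ^ expgz x q = expgz x p)%g.
Proof. by rewrite conjgE -expgzN -!expgzD; congr expgz; lia. Qed.
End IntegerPowers.

(** * Distances in a graph *)

Section Paths.
Context {V : Type} (adj : V -> V -> Prop).
Hypothesis adj_sym : forall v w, adj v w -> adj w v.

Lemma gdist_le_refl n v : gdist_le adj n v v.
Proof. by exists 0, (fun=> v). Qed.

Lemma gdist_le_adj v w : adj v w -> gdist_le adj 1 v w.
Proof. by move=> vw; exists 1%N, (fun i => if i is 0 then v else w); split=> // -[|]. Qed.

Lemma gdist_le_sym n v w : gdist_le adj n v w -> gdist_le adj n w v.
Proof.
move=> [k [p [kn p0 pk padj]]]; exists k, (fun i => p (k - i)%N).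
split; rewrite ?subn0 ?subnn // => i ik.
by apply: adj_sym; rewrite -[in X in adj _ X](subnSK ik); apply: padj; lia.
Qed.

Lemma gdist_le_trans m n v w z :
  gdist_le adj m v w -> gdist_le adj n w z -> gdist_le adj (m + n) v z.
Proof.
move=> [k [p [kn p0 pk padj]]] [l [q [ln q0 ql qadj]]].
exists (k + l)%N, (fun i => if (i < k)%N then p i else q (i - k)%N).
split=> [||| i ikl]; first exact: leq_add.
- by case: k {kn padj} pk => [|k] pk //=; rewrite subnn q0 -pk p0.
- by rewrite ltnNge leq_addr addKn.
have [ik|ki] := ltnP i k; last first.
  by rewrite ltnNge (leq_trans ki) //= subSn //; apply: qadj; lia.
have [ik'|ki] := ltnP i.+1 k; first exact: padj.
have <- : i.+1 = k by lia.
by rewrite subnn q0 -pk (_ : k = i.+1); [apply: padj|lia].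
Qed.

Lemma gdist_le_leq m n v w : (m <= n)%N -> gdist_le adj m v w -> gdist_le adj n v w.
Proof. by move=> mn [k [p [km *]]]; exists k, p; split=> //; apply: leq_trans mn. Qed.
End Paths.

(** * Infimum, supremum and a criterion for absorbability *)

Section AdditionalLength.
Context {S : finType} (M : cox_matrix S).
Hypothesis Mspherical : spherical M.
Hypothesis Scard : 1 < #|S|.
Local Notation A := (artin M).
Local Notation gen := (gen M).
Local Notation D := (para_delta M).
Local Notation Dl := (D predT).
Local Notation positive := (@posin S M predT).
Implicit Types (s t : S) (u v w : seq S) (a b c d e g h x y z : A) (P Y : pred S)
  (p q : int).

Lemma other_gen s : exists t, t != s.
Proof.
have /card_gt0P[t] : 0 < #|predC1 s| by rewrite cardC1; lia.
by exists t.
Qed.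

Lemma gen_exists : exists s : S, True.
Proof. by have /card_gt0P[s _] : 0 < #|S| by [lia]; exists s. Qed.

Lemma DeltaE : Delta M = Dl.
Proof.
(* A generator below [b] makes [b] positive, as [D_dv] requires. *)
have [s0 _] := gen_exists.
pose lub d := (forall s, prec (gen s) d) /\ (forall b, (forall s, prec (gen s) b) -> prec d b).
have DlP : lub Dl.
  split=> [s|b sb].
    have [|c pc ->] := @gen_dv_D _ _ Mspherical predT s; first by [].
    by apply/precE/dv_mulr/(posin_positive pc).
  apply/precE/D_dv => // [|s _]; last exact/precE.
  by apply: dv_positive (proj1 (precE _ _) (sb s0)); apply: posin_gen.
have [H1 H2] : lub (Delta M) := xgetPex 1 (ex_intro lub Dl DlP).
by apply: dv_anti => //; apply/precE; [apply: H2; case: DlP|case: DlP => _; apply].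
Qed.

Definition deltaz p : A := expgz Dl p.
Local Notation Dz := deltaz.

Lemma DeltazE p : expgz (Delta M) p = Dz p.
Proof. by rewrite DeltaE. Qed.

Lemma positive_conjz p a : positive a -> positive (a ^ Dz p).
Proof. by rewrite /deltaz; case: p => n /= /(posin_conjX Mspherical) => [/(_ n)|/(_ n.+1)] []. Qed.

Lemma dv_conjz p a b : dv (a ^ Dz p) (b ^ Dz p) <-> dv a b.
Proof.
rewrite /dv -conjVg -conjMg; split=> [/(positive_conjz (- p)%R)|/positive_conjz//].
by rewrite /deltaz expgzN conjgK.
Qed.

Lemma dv_Dz p q : (p <= q)%R -> dv (Dz p) (Dz q).
Proof.
move=> pq; have -> : q = (p + (`|q - p|%N : nat)%:Z)%R by lia.
by rewrite /deltaz expgzD; apply/dv_mulr/posinX/positive_D.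
Qed.

Lemma ginf_eq x p : dv (Dz p) x -> ~ dv (Dz (p + 1)%R) x -> ginf x = p.
Proof.
move=> px npx; pose E := [set p | prec (expgz (Delta M) p) x /\
  forall q, prec (expgz (Delta M) q) x -> (q <= p)%R]%classic.
have Ep : E p.
  rewrite /E /= DeltazE; split=> [|q]; first exact/precE.
  rewrite DeltazE => /precE qx; rewrite leNgt; apply/negP => pq.
  by apply: npx; apply: dv_trans qx; apply: dv_Dz; lia.
have [E1 E2] : E (ginf x) := xgetPex 0%R (ex_intro E p Ep).
by apply/eqP; rewrite eq_le; case: Ep => E3 E4; rewrite E2 // E4.
Qed.

Lemma gsup_eq x p : dv x (Dz p) -> ~ dv x (Dz (p - 1)%R) -> gsup x = p.
Proof.
move=> px npx; pose E := [set p | prec x (expgz (Delta M) p) /\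
  forall q, prec x (expgz (Delta M) q) -> (p <= q)%R]%classic.
have Ep : E p.
  rewrite /E /= DeltazE; split=> [|q]; first exact/precE.
  rewrite DeltazE => /precE qx; rewrite leNgt; apply/negP => pq.
  by apply: npx; apply: dv_trans qx _; apply: dv_Dz; lia.
have [E1 E2] : E (gsup x) := xgetPex 0%R (ex_intro E p Ep).
by apply/eqP; rewrite eq_le; case: Ep => E3 E4; rewrite E2 // E4.
Qed.

Lemma ginf_eq0 x : positive x -> ~ dv Dl x -> ginf x = 0%R.
Proof. by move=> px nx; apply: ginf_eq => //; apply/dv1. Qed.

Lemma ginf_conj x p : ginf (x ^ Dz p) = ginf x.
Proof.
rewrite /ginf; congr (xget _ _); apply/funext => q; apply/propext.
have H r : prec (expgz (Delta M) r) (x ^ Dz p) <-> prec (expgz (Delta M) r) x.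
  rewrite DeltazE !precE // -{1}(expgz_conjxx Dl r p : Dz r ^ Dz p = Dz r).
  exact: dv_conjz.
by rewrite /= H; split=> -[? H2]; split=> // r /H; apply: H2.
Qed.

Lemma gsup_conj x p : gsup (x ^ Dz p) = gsup x.
Proof.
rewrite /gsup; congr (xget _ _); apply/funext => q; apply/propext.
have H r : prec (x ^ Dz p) (expgz (Delta M) r) <-> prec x (expgz (Delta M) r).
  rewrite DeltazE !precE // -{1}(expgz_conjxx Dl r p : Dz r ^ Dz p = Dz r).
  exact: dv_conjz.
by rewrite /= H; split=> -[? H2]; split=> // r /H; apply: H2.
Qed.

(** The representative of a vertex differs from a given element by a power of [Dl], so edge labels
    are only known up to such conjugations. *)
Lemma absorbable_conj y p : absorbable y -> absorbable (y ^ Dz p).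
Proof.
move=> [H [x [Hi Hs]]]; split; first by rewrite ginf_conj gsup_conj.
by exists (x ^ Dz p); rewrite -conjMg !ginf_conj !gsup_conj.
Qed.

(** Both [x] and [x * y] have infimum 0 and supremum [n.+1], and [y] has infimum 0. *)
Lemma absorbableP x y n : positive x -> positive y -> dv (x * y) (Dl ^+ n.+1) ->
  ~ dv x (Dl ^+ n) -> ~ dv Dl (x * y) -> absorbable y.
Proof.
move=> px py xyn nx nDxy; have pxy := posinM px py.
have nDx : ~ dv Dl x by move=> /dv_trans H; apply/nDxy/H/dv_mulr.
have nDy : ~ dv Dl y.
  move=> /dvP[e pe yE]; apply: nDxy; rewrite yE.
  have -> : x * (Dl * e) = Dl * (x ^ Dl * e) by rewrite conjgE !mulgA mulgV mul1g.
  by apply/dv_mulr/posinM => //; apply: (positive_conjz 1).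
split; first by left; apply: ginf_eq0.
have sE : (n.+1%:Z - 1)%R = n by lia.
exists x; rewrite !ginf_eq0 //; split=> //.
rewrite (@gsup_eq x n.+1) // ?sE //; last exact: dv_trans (dv_mulr _ py) xyn.
apply: gsup_eq; rewrite ?sE // => /(dv_trans (dv_mulr _ py)); exact: nx.
Qed.
End AdditionalLength.

(** * Absorbable elements of proper parabolic submonoids *)

Section Absorbable.
Context {S : finType} (M : cox_matrix S).
Hypothesis Mspherical : spherical M.
Local Notation A := (artin M).
Local Notation gen := (gen M).
Local Notation D := (para_delta M).
Local Notation Dl := (D predT).
Local Notation positive := (@posin S M predT).
Implicit Types (s t : S) (u v w : seq S) (a b c d e g h x y z : A) (P Y : pred S)
  (p q : int)
  (n m k : nat).

(** The letter [s] in [P] gives [D P] positive length, so only finitely many copies can be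
    removed. *)
Lemma D_strip P a s : P s -> posin P a -> exists k b,
  [/\ posin P b, ~ dv (D P) b & a = D P ^+ k * b].
Proof.
move=> Ps; move: {2}(psize a) (leqnn (psize a)) => n; elim: n a => [|n IHn] a an Pa.
  exists 0%N, a; split; rewrite ?mul1g // => /(psize_dv Mspherical (positive_D Mspherical P)).
  have [c Pc ->] := gen_dv_D Mspherical Ps.
  by rewrite psizeM ?psize_gen //; [lia|apply: posin_gen|apply: posin_positive Pc].
have [Da|nDa] := pselect (dv (D P) a); last by exists 0%N, a; split; rewrite ?mul1g.
have /dvP[b pb aE] := Da; have pD := positive_D Mspherical P.
have [|_ Pb] := @posin_split _ _ Mspherical P (D P) b pD pb; first by rewrite -aE.
have [|k [c [Pc nDc bE]]] := IHn b _ Pb.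
  move: an; rewrite aE psizeM //; have [c Pc ->] := gen_dv_D Mspherical Ps.
  by rewrite psizeM ?psize_gen //; [lia|apply: posin_gen|apply: posin_positive Pc].
by exists k.+1, c; split; rewrite // aE bE expgS mulgA.
Qed.

Lemma not_dv_posin Y t a : ~~ Y t -> posin Y a -> ~ dv (gen t) a.
Proof.
move=> nYt Ya /dvP[c pc aE]; move: Ya; rewrite aE.
case/(posin_split Mspherical (@posin_gen _ M predT t isT) pc) => /(posinE Mspherical Y [:: t]) /=.
by rewrite (negbTE nYt).
Qed.

Lemma not_Dl_dv Y t a : ~~ Y t -> posin Y a -> ~ dv Dl a.
Proof.
move=> nYt Ya Da; apply: (not_dv_posin nYt Ya); apply: dv_trans Da.
have [|c pc ->] := @gen_dv_D _ _ Mspherical predT t; first by [].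
exact: dv_mulr.
Qed.

Hypothesis Scard : 1 < #|S|.

(* The absorbing element is [compl Y N], with [N] even so that it commutes with
   the elements of the parabolic submonoid. *)
Lemma absorbable_parabolic Y t a : ~~ Y t -> posin Y a -> ~ dv (D Y) a -> absorbable a.
Proof.
move=> nYt Ya nDa; have pa := posin_positive Ya.
have [m /(_ m.+1.*2)] := posin_dv_DX Mspherical Ya.
case=> [|c Yc acE]; first by rewrite -addnn; lia.
have pc := posin_positive Yc.
set N := m.+1.*2 in acE; have NE : N = m.*2.+2 by rewrite /N doubleS.
pose x := compl M Y N; have px : positive x by apply: positive_compl.
have xD : x * D Y ^+ N = Dl ^+ N.
  rewrite /x /compl -mulgA.
  have /(D_even_comm Mspherical) : positive (D Y ^+ N) by apply/posinX/positive_D.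
  by move/(_ m.+1) => /commute_sym ->; rewrite mulKg.
have xa : x * a = a * x.
  have c1 := D_even_comm Mspherical m.+1 Ya; have c2 := D_even_comm Mspherical m.+1 pa.
  by apply: commute_sym; apply: commuteM => //; apply: commuteV.
have conjD n b : positive b -> positive (b ^ (Dl ^+ n)).
  by move=> pb; case: (posin_conjX Mspherical n pb).
apply: (@absorbableP _ _ Mspherical Scard x a m.*2.+1) => //; rewrite -?NE.
- by rewrite -xD acE mulgA; apply: dv_mulr.
(* If [x] divided [Dl ^+ N.-1], cancelling [x] in [x * D Y ^+ N = Dl ^+ N] would make [Dl] divide a
   power of [D Y], which does not involve [t]. *)
- move=> /dvP[e pe E]; apply: (@not_Dl_dv Y t (D Y ^+ N)) => //.
    by apply/posinX/posin_D.
  have E2 : D Y ^+ N = e * Dl.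
    by apply: (mulgI x); rewrite xD mulgA -E -expgSr NE.
  rewrite E2 (_ : e * Dl = Dl * e ^ Dl); last by rewrite conjgE mulVKg.
  by apply/dv_mulr/(conjD 1%N).
(* If [Dl] divided [x * a], the cofactor [c] of [a] in [D Y ^+ N] would divide [Dl ^+ N.-1], hence
   [D Y ^+ N.-1] by [posin_dv_Dl]; the factor [D Y] left over would then divide [a]. *)
- move=> /dvP[e pe E]; apply: nDa.
  have E1 : e * c = Dl ^+ m.*2.+1.
    apply: (mulgI Dl); rewrite mulgA -E -mulgA -acE xD NE.
    by rewrite [in LHS]expgS.
  have cD : dv c (Dl ^+ m.*2.+1).
    apply/dvP; exists (e ^ (Dl ^+ m.*2.+1)); first exact: conjD.
    by rewrite conjgE -E1 invgM !mulgA mulgV mul1g mulVg mul1g.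
  have /dvP[f pf fE] := posin_dv_Dl Mspherical Yc cD.
  have [|_ Yf] := @posin_split _ _ Mspherical Y c f pc pf.
    by rewrite -fE; apply/posinX/posin_D.
  have -> : a = D Y * f ^ (D Y ^- m.*2.+1).
    apply: (mulIg c); rewrite -acE NE expgS conjgE invgK -!mulgA; congr (_ * _).
    by rewrite {3}fE invgM -!mulgA mulVKg mulVg mulg1.
  by apply/dv_mulr; case: (posin_conjX Mspherical m.*2.+1 Yf) => _ /posin_positive.
Qed.
End Absorbable.

(** * Absorbing ribbons, fractions, and representatives of vertices *)

Section Near.
Context {S : finType} (M : cox_matrix S).
Hypothesis Mspherical : spherical M.
Hypothesis Scard : 1 < #|S|.
Local Notation A := (artin M).
Local Notation gen := (gen M).
Local Notation D := (para_delta M).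
Local Notation Dl := (D predT).
Local Notation Dz := (deltaz M).
Local Notation positive := (@posin S M predT).
Implicit Types (s t : S) (u v w : seq S) (a b c d e g h x y z : A) (P Y : pred S)
  (p q : int)
  (n m k : nat).

Lemma posin_pow_gen s n : posin (pred1 s) (gen s ^+ n).
Proof. by apply/posinX/posin_gen; rewrite /= eqxx. Qed.

Lemma ribbon_pow s t y n : gen s * y = y * gen t -> gen s ^+ n * y = y * gen t ^+ n.
Proof.
move=> E; elim: n => [|n IHn]; first by rewrite mulg1 mul1g.
by rewrite expgS -mulgA IHn mulgA E -mulgA -expgS.
Qed.

(** The element [y] is absorbed by [gen s ^+ m.+1], where [y] divides [Dl ^+ m.+1]. *)
Lemma absorbable_ribbon s t y : positive y -> gen s * y = y * gen t ->
  ~ dv (gen s) y -> ~ dv (compl M (pred1 s) 1) y -> absorbable y.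
Proof.
move=> py E nsy ndy; have [m /(_ m.+1 (leqnSn m))[c pc yD]] := posin_dv_DX Mspherical py.
pose x := gen s ^+ m.+1.
have px : positive x := posin_positive (posin_pow_gen s m.+1).
have xyE : x * y = y * gen t ^+ m.+1 := ribbon_pow m.+1 E.
have pt k : positive (gen t ^+ k) := posin_positive (posin_pow_gen t k).
apply: (@absorbableP _ _ Mspherical Scard x y m) => //.
(* The product [x * y] is the least common multiple of [x] and [y], which both divide [Dl ^+ m.+1]:
   that multiple is [y * gen t ^+ j], equal to [gen s ^+ j * y], and [j < m.+1] would make [gen s]
   divide [y]. *)
- have [l [pl xl yl lP]] := lcm_exists Mspherical px py.
  suff -> : x * y = l.
    apply: lP; last by rewrite yD; apply: dv_mulr.
    by rewrite (complE M (pred1 s)) D_pred1 //; apply/dv_mulr/positive_compl.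
  have /dvP[e pe lE] := yl.
  have := lP _ (dv_mulr _ py); rewrite xyE => /(_ (dv_mulr _ (pt _))).
  rewrite lE => /dv_mull et; have /dvP[f pf tE] := et.
  have [|/posin_pow[j eE] _] := @posin_split _ _ Mspherical (pred1 t) e f pe pf.
    by rewrite -tE; apply: posin_pow_gen.
  have := psize_dv Mspherical pe et; rewrite eE -!pos_nseq !psize_pos // !size_nseq.
  rewrite !pos_nseq leq_eqVlt => /orP[/eqP->//|jm].
  case: nsy; apply: (@dv_trans _ _ (gen s ^+ (m.+1 - j))).
    rewrite subSn // expgS; exact/dv_mulr/posin_positive/posin_pow_gen.
  apply/(@dv_mull _ _ (gen s ^+ j)); rewrite -expgnDr subnKC; last exact: ltnW.
  by rewrite (ribbon_pow j E) -eE -lE.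
- exact: gen_pow_dv_Dl.
(* Write [Dl = gen s * d]. If [Dl] divided [x * y], then [d] would divide [gen s ^+ m * y]; by the
   ribbon property of [d] the factors [gen s] are removed one at a time until [d] divides [y]. *)
- have DE : Dl = gen s * compl M (pred1 s) 1 by rewrite compl1 D_pred1 // mulVKg.
  rewrite {1}DE /x expgS -mulgA => /dv_mull; elim: m {yD x px xyE} => [|m IHm].
    by rewrite mul1g.
  rewrite expgS -mulgA => /dvP[e pe dE]; apply: IHm.
  have [|s1 [s2 [_ E1 _ nsd]]] := @compl1_gen _ _ Mspherical (pred1 s) s; first by rewrite /= eqxx.
  have pd := positive_compl1 Mspherical (pred1 s).
  have /(ribbon_dv Mspherical pd pe E1 nsd) : dv (gen s) (compl M (pred1 s) 1 * e).
    rewrite -dE; apply/dv_mulr/posinM => //; exact/posin_positive/posin_pow_gen.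
  case/dvP=> e' pe' eE; apply/dvP; exists e' => //.
  by apply: (mulgI (gen s)); rewrite dE eE mulgA -E1 -mulgA.
Qed.

Lemma psize_compl1 s : 0 < psize (compl M (pred1 s) 1).
Proof.
have [t ts] := other_gen Scard s; have pd := positive_compl1 Mspherical (pred1 s).
case: (pd) => -[|q u] _ dE; last by rewrite dE psize_pos.
have := @not_Dl_dv _ _ Mspherical (pred1 s) t (gen s) ts; case.
  by apply: posin_gen; rewrite /= eqxx.
rewrite -[Dl](mulVKg (D (pred1 s))) -[_^-1 * _]compl1 dE pos_nil mulg1 D_pred1 //.
exact: dv_refl.
Qed.

(** Factors [s^-1 * Dl] are split off while they divide [y]. Each one changes [s] into its conjugate
    by [Dl], so [k] of them multiply to [gen s ^- k * Dl ^+ k]; what remains is absorbable. The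
    length of [y] bounds [k]. *)
Lemma ribbon_decomp s t y : positive y -> gen s * y = y * gen t ->
  ~ dv (gen s) y -> exists k z, absorbable z /\ y = gen s ^- k * Dl ^+ k * z.
Proof.
have [n] := ubnP (psize y); elim: n s y => // n IHn s y yn py E nsy.
have [/dvP[z pz yE]|nd] := pselect (dv (compl M (pred1 s) 1) y); last first.
  exists 0%N, y; split; first exact: (absorbable_ribbon py E nsy nd).
  by rewrite invg1 !mul1g.
have pd := positive_compl1 Mspherical (pred1 s).
have [|s1 [s2 [/eqP -> E1 s2E nsd]]] := @compl1_gen _ _ Mspherical (pred1 s) s; first by rewrite /= eqxx.
have [|||k [z' [az zE]]] := IHn s2 z _ pz.
- by move: yn; rewrite yE psizeM //; have := psize_compl1 s; lia.
- by apply: (mulgI (compl M (pred1 s) 1)); rewrite mulgA -E1 -mulgA -yE E yE mulgA.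
- move=> /dvP[c pc zc]; apply: nsy.
  by rewrite yE zc mulgA -E1 -mulgA; apply/dv_mulr/posinM.
exists k.+1, z'; split=> //.
rewrite yE zE compl1 D_pred1 // -s2E -conjXg conjgE.
by rewrite expgSr expgS !invgM invgK !mulgA mulgK.
Qed.

(** * A norm bounding distances in the additional length graph *)

(** The parabolic subgroup of [P] as left fractions with powers of [D P] as denominators, as
    [std_parabolicE] confirms. *)
Definition para_frac P a := exists n b, posin P b /\ a = D P ^- n * b.

Lemma para_frac_subgroup P : is_subgroup (para_frac P).
Proof.
have conjV n b : posin P b -> posin P (b ^ (D P ^- n)).
  by move=> Pb; case: (posin_conjX Mspherical n Pb).
split; first split.
- by exists 0%N, 1; split; [apply: posin1|rewrite invg1 mulg1].
- move=> _ _ [n [b [Pb ->]]] [m [c [Pc ->]]].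
  exists (m + n)%N, (b ^ (D P ^- m) * c); split; first by apply: posinM => //; apply: conjV.
  by rewrite expgnDr invgM conjgE invgK !mulgA mulgVK.
- move=> _ [n [b [Pb ->]]]; have [m /(_ m (leqnn m))[c Pc E]] := posin_dv_DX Mspherical Pb.
  exists m, (c ^ (D P ^- m) * D P ^+ n); split.
    by apply: posinM; [apply: conjV|apply/posinX/posin_D].
  by rewrite invgM invgK conjgE invgK !mulgA mulVg mul1g E invgM mulgA mulgV mul1g.
Qed.

Lemma para_frac_gen P s : P s -> para_frac P (gen s).
Proof. by move=> Ps; exists 0%N, (gen s); rewrite invg1 mul1g; split=> //; apply: posin_gen. Qed.

Lemma para_frac_all a : para_frac predT a.
Proof.
have [[H1 HM] HV] := para_frac_subgroup predT.
elim/quotW: a; elim=> [|[s b] l IHl]; first exact: H1.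
have -> : \pi_(pres_group (artin_rel M)) ((s, b) :: l) =
    (\pi_(pres_group (artin_rel M)) [:: (s, b)] : A) * \pi_(pres_group (artin_rel M)) l.
  by apply: esym; apply: pres_mulE.
apply: HM => //; case: b; first exact: para_frac_gen.
suff -> : \pi_(pres_group (artin_rel M)) [:: (s, false)] = (gen s)^-1.
  by apply: HV; apply: para_frac_gen.
apply: (mulgI (gen s)); rewrite mulgV; apply: etrans (pres_mulE _ [:: (s, true)] _) _.
exact/pres_piP/(PresInv _ s true).
Qed.

Lemma Dcoset_in g h : Dcoset g h <-> exists p, h = g * Dz p.
Proof.
by split=> [[p _ <-]|[p ->]]; exists p; rewrite ?DeltazE.
Qed.

Lemma Dcoset_mul g p : Dcoset (g * Dz p) = Dcoset g.
Proof.
apply/funext => h; apply/propext; rewrite !Dcoset_in.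
split=> -[q ->]; first by exists (p + q)%R; rewrite /deltaz expgzD mulgA.
by exists (q - p)%R; rewrite /deltaz -mulgA -expgzD; congr (_ * expgz _ _); lia.
Qed.

(** Stripping powers of [Dl] from a numerator of [g] exhibits an element of infimum 0 in the coset,
    so [AL_rep] is not the default value. *)
Lemma AL_rep_Dcoset g : exists p, AL_rep (Dcoset g) = g * Dz p.
Proof.
have [s0 _] := gen_exists Scard.
have [n [b [pb gE]]] := para_frac_all g.
have [k [c [pc nDc bE]]] := @D_strip _ _ Mspherical predT b s0 isT pb.
pose p : int := (n%:Z - k%:Z)%R.
have gp : g * Dz p = c ^ Dz p.
  rewrite conjgE mulgA gE bE; congr (_ * _); rewrite mulgA; congr (_ * _).
  by rewrite /deltaz -expgzN opprB addrC expgzD expgzN.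
have [] := @xgetPex _ 1 [set a | Dcoset g a /\ ginf a = 0%R]%classic; last first.
  by move=> /Dcoset_in[q E] _; exists q.
exists (g * Dz p); split; first by apply/Dcoset_in; exists p.
by rewrite gp ginf_conj // ginf_eq0.
Qed.
End Near.

(** * Distances moved by right multiplication, and elements normalizing standard parabolic
    subgroups *)

Section Elliptic.
Context {S : finType} (M : cox_matrix S).
Hypothesis Mspherical : spherical M.
Hypothesis Scard : 1 < #|S|.
Local Notation A := (artin M).
Local Notation pos := (pos_word M).
Local Notation gen := (gen M).
Local Notation D := (para_delta M).
Local Notation Dl := (D predT).
Local Notation Dz := (deltaz M).
Local Notation positive := (@posin S M predT).
Implicit Types (s t : S) (u v w : seq S) (a b c d e g h x y z : A) (P Y : pred S)
  (p q : int)
  (n m k : nat).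

Local Notation adj := (@AL_adj S M).

Lemma AL_adj_sym (v w : set A) : adj v w -> adj w v.
Proof. by case=> Vv Vw [E|E]; split=> //; [right|left]. Qed.

(** The representative of the coset of [g] is [g * Dz p] for an unknown [p], and the edge is then
    labelled by [a ^ Dz p]. *)
Lemma AL_adjP g a :
  (forall p, absorbable (a ^ Dz p)) \/
  (forall p, [/\ simple_elt (a ^ Dz p), a ^ Dz p <> 1 & a ^ Dz p <> Delta M]) ->
  adj (Dcoset g) (Dcoset (g * a)).
Proof.
move=> Ha; split; [by exists g|by exists (g * a)|left].
have [p rE] := AL_rep_Dcoset Mspherical Scard g.
have Hp : Dcoset (g * a) (AL_rep (Dcoset g) * a ^ Dz p).
  by apply/(Dcoset_in Mspherical Scard); exists p; rewrite rE conjgE !mulgA mulgK.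
case: Ha => [/(_ p) Ha|/(_ p)[a1 a2 a3]]; [right|left]; by exists (a ^ Dz p).
Qed.

(** Quantifying over [g] makes the bound subadditive without an appeal to the invariance of the
    graph under left multiplication. *)
Definition near n h := forall g, gdist_le adj n (Dcoset g) (Dcoset (g * h)).

Lemma near_mul m n g h : near m g -> near n h -> near (m + n) (g * h).
Proof.
move=> ng nh x; apply: gdist_le_trans (ng x) _.
by rewrite mulgA; apply: nh.
Qed.

Lemma near_inv n h : near n h -> near n h^-1.
Proof.
move=> nh g; apply: (gdist_le_sym AL_adj_sym).
by have := nh (g * h^-1); rewrite mulgVK.
Qed.

Lemma near_leq m n h : m <= n -> near m h -> near n h.
Proof. by move=> mn nh g; apply: gdist_le_leq mn (nh g). Qed.

Lemma near_Dz p : near 0 (Dz p).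
Proof. by move=> g; rewrite (Dcoset_mul Mspherical Scard); apply: gdist_le_refl. Qed.

Lemma near_DlX n : near 0 (Dl ^+ n).
Proof. exact: (near_Dz n). Qed.

Lemma near_absorbable a : absorbable a -> near 1 a.
Proof.
by move=> aa g; apply/gdist_le_adj/AL_adjP; left=> p; apply: absorbable_conj.
Qed.

Lemma near_gen s : near 1 (gen s).
Proof.
move=> g; apply/gdist_le_adj/AL_adjP; right=> p.
have ps : positive (gen s) by apply: posin_gen.
have DzD : Dl ^ Dz p = Dl by apply: (expgz_conjxx Dl 1 p).
have [t ts] := other_gen Scard s.
split.
- split; apply/precE.
    by apply/dv1/(positive_conjz Mspherical).
  rewrite (DeltaE Mspherical Scard) -DzD.
  apply/(dv_conjz Mspherical); have [|c pc ->] := @gen_dv_D _ _ Mspherical predT s; first by [].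
  exact: dv_mulr.
- by move/eqP; rewrite conjg_eq1 => /eqP; apply: gen_neq1.
- rewrite (DeltaE Mspherical Scard) -DzD => /conjg_inj E.
  apply: (@not_Dl_dv _ _ Mspherical (pred1 s) t (gen s) ts).
    by apply: posin_gen; rewrite /= eqxx.
  by rewrite -E; apply: dv_refl.
Qed.

Lemma near_pos u : near (size u) (pos u).
Proof.
elim: u => [|s u IHu]; first by rewrite pos_nil; exact: (near_DlX 0).
by rewrite pos_cons -[size _]add1n; apply: near_mul (near_gen s) IHu.
Qed.

Lemma near_exists h : exists n, near n h.
Proof.
have [n [_ [[u _ ->] ->]]] := para_frac_all Mspherical h.
by exists (0 + size u); apply: near_mul (near_inv (near_DlX n)) (near_pos u).
Qed.

Lemma AL_act_Dcoset x g : AL_act x (Dcoset g) = Dcoset (x * g).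
Proof.
apply/funext => h; apply/propext; rewrite (Dcoset_in Mspherical Scard).
split=> [[_ /(Dcoset_in Mspherical Scard)[p ->] <-]|[p ->]].
  by exists p; rewrite mulgA.
by exists (g * Dz p); [apply/(Dcoset_in Mspherical Scard); exists p|rewrite mulgA].
Qed.

(** Two orbit points [x^p g] and [x^q g] differ on the right by the conjugate of [x^(q-p)] by [g],
    and conjugating costs twice the norm of [g]. *)
Lemma AL_ellipticP x : (exists n, forall p, near n (expgz x p)) -> AL_elliptic x.
Proof.
move=> [n nx] _ [g ->]; have [m nm] := near_exists g.
exists (m + n + m) => _ _ [p _ <-] [q _ <-]; rewrite !AL_act_Dcoset.
have -> : expgz x q * g = expgz x p * g * (g^-1 * expgz x (- p + q) * g).
  by rewrite expgzD expgzN !mulgA mulgK mulgV mul1g.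
exact: (near_mul (near_mul (near_inv nm) (nx _)) nm).
Qed.

(** Division of the exponent by [k] leaves finitely many remainders. *)
Lemma near_pow x k : 0 < k ->
  (exists n, forall p, near n (expgz (x ^+ k) p)) -> exists n, forall p, near n (expgz x p).
Proof.
move=> k0 [n nx].
have [m nm] : exists m, forall r, r < k -> near m (x ^+ r).
  elim: k {k0 nx} => [|k [m IHm]]; first by exists 0.
  have [l nl] := near_exists (x ^+ k); exists (m + l) => r; rewrite ltnS leq_eqVlt.
  case/predU1P=> [->|/IHm]; first by apply: near_leq nl; apply: leq_addl.
  by apply: near_leq; apply: leq_addr.
exists (n + m) => p; rewrite (divz_eq p k) expgzD mulrC expgzM.
apply: near_mul => //.
have : (0 <= modz p k)%R by apply: modz_ge0; lia.
have : (modz p k < k%:Z)%R by apply: ltz_pmod; lia.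
by case: (modz p k) => // r rk _; apply: nm.
Qed.

(** * Normalizers of parabolic subgroups *)

(** In [ribbon_decomp] the power of [gen s] and the absorbable factor cost 1 each, the power of [Dl]
    nothing. *)
Lemma near_ribbon s t y : (forall k, near 1 (gen s ^+ k)) -> positive y ->
  gen s * y = y * gen t -> ~ dv (gen s) y -> near 2 y.
Proof.
move=> ns py E nsy; have [k [z [az ->]]] := ribbon_decomp Mspherical Scard py E nsy.
apply: (@near_mul 1 1); last exact: near_absorbable.
exact: (@near_mul 1 0) (near_inv (ns k)) (near_DlX k).
Qed.

Section Parabolic.
Context (Y : pred S) (s1 s2 t0 : S).
Hypotheses (Ys1 : Y s1) (Ys2 : Y s2) (s12 : s1 != s2) (Yt0 : ~~ Y t0).

(** Another letter of [Y] divides [D Y] but no power of [gen s]. *)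
Lemma not_D_dv_pow s n : ~ dv (D Y) (gen s ^+ n).
Proof.
have [r Yr rs] : exists2 r, Y r & r != s.
  by have [<-|?] := eqVneq s1 s; [exists s2; rewrite // eq_sym|exists s1].
move=> Dr; apply: (@not_dv_posin _ _ Mspherical (pred1 s) r _ rs (posin_pow_gen M s n)).
apply: dv_trans Dr; have [c Yc ->] := gen_dv_D Mspherical Yr.
exact/dv_mulr/posin_positive/Yc.
Qed.

Lemma near_gen_pow s k : Y s -> near 1 (gen s ^+ k).
Proof.
move=> Ys; apply/near_absorbable/(absorbable_parabolic Mspherical Scard Yt0).
  exact/posinX/posin_gen.
exact: not_D_dv_pow.
Qed.

(* [D Y ^+ k = gen s1 ^+ k * v], where neither factor is divisible by [D Y]. *)
Lemma near_D_pow k : near 2 (D Y ^+ k).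
Proof.
have pY n := @posinX _ M Y (D Y) n (posin_D Mspherical Y).
have [v Yv vE] : exists2 v, posin Y v & D Y ^+ k = gen s1 ^+ k * v.
  elim: k => [|k [v Yv vE]]; first by exists 1; [apply: posin1|rewrite mulg1].
  have [c Yc cE] := gen_dv_D Mspherical Ys1.
  exists (v * c ^ (D Y ^+ k)); last first.
    by rewrite expgS {1}cE -mulgA [c * _]conjgC vE expgS !mulgA.
  by apply: posinM => //; case: (posin_conjX Mspherical k Yc).
rewrite vE; apply: (@near_mul 1 1); first exact: near_gen_pow.
apply/near_absorbable/(absorbable_parabolic Mspherical Scard Yt0) => //.
case: k vE => [|k] vE.
  have -> : v = gen s1 ^+ 0 by rewrite -[v]mul1g -[1 * v]vE.
  exact: not_D_dv_pow.
(* If [D Y] divided [v], moving it to the left through [gen s1 ^+ k.+1] and cancelling would make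
   [gen s ^+ k.+1] divide [D Y ^+ k], hence [Dl ^+ k]. *)
move=> /dvP[e pe vD]; have [s [Ys E1 E2]] := D_gen Mspherical Ys1.
apply: (@gen_pow_dv_Dl _ _ Mspherical s k).
apply: (@dv_trans _ _ (D Y ^+ k)); last first.
  by rewrite (complE M Y); apply/dv_mulr/positive_compl.
apply/dvP; exists e => //; apply: (mulgI (D Y)).
by rewrite mulgA -(ribbon_pow k.+1 E1) -expgS vE vD mulgA.
Qed.

Lemma near_parabolic a : posin Y a -> near 3 a.
Proof.
move=> /(D_strip Mspherical Ys1)[k [b [Yb nb ->]]].
apply: (@near_mul 2 1); first exact: near_D_pow.
exact/near_absorbable/(absorbable_parabolic Mspherical Scard Yt0).
Qed.
End Parabolic.

Lemma reduce_exists P a : positive a -> exists b c,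
  [/\ posin P b, positive c, pred_reduced P c & a = b * c].
Proof.
have [n] := ubnP (psize a); elim: n a => // n IHn a an pa.
have [[s [Ps /dvP[d pd aE]]]|H] := pselect (exists s, P s /\ dv (gen s) a); last first.
  exists 1, a; split; rewrite ?mul1g //; first exact: posin1.
  by move=> s Ps sa; apply: H; exists s.
have [|b [c [Pb pc rc dE]]] := IHn d _ pd.
  by move: an; rewrite aE psizeM ?psize_gen //; apply: posin_gen.
exists (gen s * b), c; split=> //; last by rewrite aE dE mulgA.
by apply: posinM => //; apply: posin_gen.
Qed.

Lemma std_parabolicE (X : {set S}) a : std_parabolic M X a <-> para_frac (fun s => s \in X) a.
Proof.
split=> [Ha|[n [_ [[u Xu ->] ->]]] H [[[H1 HM] HV] HX]].
  apply: (Ha (@para_frac S M (fun s => s \in X))); split; first exact: para_frac_subgroup.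
  by move=> _ [s Xs <-]; apply: para_frac_gen.
have Hpos l : all (fun s => s \in X) l -> H (pos l).
  elim: l => [|s l IHl] /=; first by move=> _; exact: H1.
  by case/andP=> Xs /IHl Hl; rewrite pos_cons; apply: HM => //; apply: HX; exists s.
apply: (HM _ _ _ (Hpos _ Xu)).
apply: HV; elim: n => [|n IHn]; first exact: H1.
rewrite expgS; apply: (HM) => //; have [l Xl ->] := posin_D Mspherical (fun s => s \in X).
exact: Hpos.
Qed.

Lemma Dl_even_central a n : commute a (Dl ^+ n.*2).
Proof.
have [m [b [pb ->]]] := para_frac_all Mspherical a.
apply/commute_sym/commuteM; last exact/commute_sym/D_even_comm.
exact/commuteV/commuteX2.
Qed.

(** By [reduced_dv], [b] and [b'] divide each other. *)
Lemma reduce_uniq P b b' c c' : posin P b -> posin P b' -> positive c -> positive c' ->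
  pred_reduced P c -> pred_reduced P c' -> b * c = b' * c' -> b = b' /\ c = c'.
Proof.
move=> Pb Pb' pc pc' rc rc' E.
have bb' : b = b'.
  apply: dv_anti => //; first apply: (reduced_dv Mspherical Pb Pb' pc' rc').
    by rewrite -E; apply: dv_mulr.
  by apply: (reduced_dv Mspherical Pb' Pb pc rc); rewrite E; apply: dv_mulr.
by split=> //; apply: (mulgI b); rewrite E bb'.
Qed.

(** Split [y * gen s] as [g * y2] with [g] in the submonoid of [P] and [y2] reduced. Clearing the
    denominator of [y s y^-1] and [reduce_uniq] give [y2 = y], and comparing lengths makes [g] a
    single letter. *)
Lemma normalizer_ribbon P y s : positive y -> pred_reduced P y -> P s ->
  para_frac P (gen s ^ y^-1) -> exists2 t, P t & gen t * y = y * gen s.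
Proof.
move=> py ry Ps [k [q [Pq E]]].
have ps : positive (gen s) by apply: posin_gen.
have [g [y2 [Pg py2 ry2 ysE]]] := reduce_exists P (posinM py ps).
have PD : posin P (D P ^+ k * g) by apply: posinM => //; apply/posinX/posin_D.
have [|_ y2E] := reduce_uniq PD Pq py2 py ry2 ry.
  rewrite -mulgA -ysE; apply: (mulIg y^-1); apply: (mulgI (D P ^- k)).
  by rewrite !mulgA mulVg mul1g mulgK -E conjgE invgK !mulgA.
move: (congr1 (@psize S M) ysE); rewrite y2E in ysE *.
rewrite (psizeM Mspherical py ps) (psizeM Mspherical (posin_positive Pg) py) psize_gen //.
case: Pg => -[|t [|r l]] Pl gE; rewrite gE psize_pos //=.
- by lia.
- by move=> _; exists t; [move: Pl => /andP[]|rewrite ysE gE pos_cons pos_nil mulg1].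
- by lia.
Qed.

Lemma near_normalizer (X : {set S}) x : 2 < #|S| -> X != finset.set0 -> X != finset.setT ->
  PA_act x (std_parabolic M X) = std_parabolic M X -> near 5 x.
Proof.
move=> S3 /set0Pn[s Xs] XT Hx; set P := fun r => r \in X.
have [t0 nXt0] : exists t0, t0 \notin X.
  by apply/existsP; rewrite -negb_forall; apply: contra XT => /forallP H; apply/eqP/setP => r; rewrite inE H.
have st0 : s != t0 by apply: contraNneq nXt0 => <-.
(* Rank at least 3 gives a second letter [s2] in the complement [Y] of [t0]. *)
have [s2 s2E] : exists s2, s2 \notin [:: s; t0].
  pose C := [predC [:: s; t0]]; have cE : #|[:: s; t0]| + #|C| = #|S| := cardC _.
  have le2 : #|[:: s; t0]| <= 2 := card_size _.
  by have /card_gt0P[r] : 0 < #|C| by [lia]; exists r.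
move: s2E; rewrite !inE negb_or => /andP[s2s s2t0].
pose Y := predC1 t0.
have PY : subpred P Y by move=> r Xr; apply: contraNneq nXt0 => <-.
have nearY a : posin Y a -> near 3 a.
  by apply: (@near_parabolic Y s s2 t0); rewrite /Y /= ?eqxx // eq_sym.
have [n [b [pb xE]]] := para_frac_all Mspherical x.
pose x0 := Dl ^+ n * b; have px0 : positive x0 by apply: posinM => //; apply/posinX/positive_D.
have xE0 : x = Dl ^- n.*2 * x0.
  by rewrite xE /x0 -addnn expgnDr invgM !mulgA mulgVK.
have [a [y [Pa py ry x0E]]] := reduce_exists P px0.
have frac_sub : is_subgroup (@para_frac S M P) := para_frac_subgroup Mspherical P.
have [t Xt ty] : exists2 t, P t & gen t * y = y * gen s.
  apply: normalizer_ribbon => //.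
  have fa : para_frac P a by exists 0%N, a; rewrite invg1 mul1g.
  have /std_parabolicE fs : std_parabolic M X (gen s ^ x^-1).
    by rewrite -Hx; exists (gen s) => //; apply/std_parabolicE/(@para_frac_gen _ _ P).
  (* The central factor [Dl ^+ n.*2] drops out of the conjugation, and [a] lies in the parabolic
     subgroup, so [y s y^-1] does too. *)
  have -> : gen s ^ y^-1 = a^-1 * (gen s ^ x^-1) * a.
    rewrite xE0 x0E !invgM invgK !conjgM -mulgA -conjgE.
    have -> z : z ^ (Dl ^+ n.*2) = z by rewrite conjgE Dl_even_central mulKg.
    by rewrite conjgKV.
  have [[_ HM] HV] := frac_sub.
  by apply: (HM) => //; apply: (HM) => //; exact: HV.
(* The bound 5 is 0 for the power of [Dl], 3 for [a] and 2 for the ribbon [y]. *)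
rewrite xE0 x0E; apply: (@near_mul 0 5); first exact/near_inv/near_DlX.
apply: (@near_mul 3 2); first exact/nearY/(posin_sub PY).
apply: near_ribbon ty _ => //; last exact: ry.
move=> k; apply: (@near_gen_pow Y s s2 t0); rewrite /Y /= ?eqxx //; first by rewrite eq_sym.
exact: PY.
Qed.
End Elliptic.

(** * Parabolic normalizers, simplices and periodic elements *)

Section Main.
Context {S : finType} (M : cox_matrix S).
Hypothesis Mspherical : spherical M.
Hypothesis S3 : 2 < #|S|.
Local Notation A := (artin M).
Local Notation gen := (gen M).
Implicit Types (s t : S) (u v w : seq S) (a b c d e g h x y z : A) (P Y : pred S)
  (p q : int)
  (n m k : nat).

Let Scard : 1 < #|S| := ltnW S3.

Local Open Scope classical_set_scope.

Lemma conj_setM (G : groupType) (H : set G) (g h : G) :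
  conj_set H (g * h) = conj_set (conj_set H g) h.
Proof. by rewrite /conj_set image_comp; congr image; apply/funext => a /=; rewrite conjgM. Qed.

Lemma conj_set1 (G : groupType) (H : set G) : conj_set H 1 = H.
Proof. by rewrite /conj_set -[RHS]image_id; congr image; apply/funext => a /=; rewrite conjg1. Qed.

Lemma PA_actM x y (Q : set A) : PA_act (x * y) Q = PA_act x (PA_act y Q).
Proof. by rewrite /PA_act invgM conj_setM. Qed.

Lemma PA_act1 (Q : set A) : PA_act 1 Q = Q.
Proof. by rewrite /PA_act invg1 conj_set1. Qed.

Lemma PA_actK x (Q : set A) : PA_act x^-1 (PA_act x Q) = Q.
Proof. by rewrite -PA_actM mulVg PA_act1. Qed.

Lemma PA_actX x (Q : set A) n : PA_act (x ^+ n) Q = iter n (PA_act x) Q.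
Proof. by elim: n => [|n IHn]; rewrite ?PA_act1 // expgS PA_actM IHn. Qed.

Lemma PA_act_fixz x (Q : set A) p : PA_act x Q = Q -> PA_act (expgz x p) Q = Q.
Proof.
move=> xQ; have fixX n : PA_act (x ^+ n) Q = Q by rewrite PA_actX; elim: n => //= n ->.
by case: p => n /=; rewrite // -{1}[Q](fixX n.+1) PA_actK.
Qed.

Lemma std_parabolic_set0 : std_parabolic M finset.set0 = [set 1].
Proof.
apply/seteqP; split=> a.
  move/(_ [set 1]); apply; split; last by move=> b [s /=]; rewrite inE.
  by split; [split=> // b c -> ->; rewrite mulg1|move=> b ->; rewrite invg1].
by move=> -> H [[[]]].
Qed.

Lemma std_parabolic_setT : std_parabolic M finset.setT = [set: A].
Proof.
apply/seteqP; split=> // a _; apply/std_parabolicE => //.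
rewrite (_ : (fun s => s \in _) = predT); first exact: para_frac_all.
by apply/funext => s; rewrite inE.
Qed.

(** All powers of [x] normalize [Q]. Conjugating them by [alpha] reduces to a standard parabolic
    subgroup, at a cost that does not depend on the exponent. *)
Lemma near_normalizes (Q : set A) x : parabolic Q -> Q <> [set 1] -> Q <> [set: A] ->
  PA_act x Q = Q -> exists n, forall p, near n (expgz x p).
Proof.
move=> [X [alpha QE]] Q1 QT xQ; set H := std_parabolic M X in QE.
have X0 : X != finset.set0.
  apply/eqP => X0; apply: Q1; rewrite QE /H X0 std_parabolic_set0 /conj_set.
  by rewrite image_set1 conj1g.
have XT : X != finset.setT.
  apply/eqP => XT; apply: QT; rewrite QE /H XT std_parabolic_setT.
  by apply/seteqP; split=> // a _; exists (a ^ alpha^-1); rewrite ?conjgKV.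
have [m nm] := near_exists Mspherical Scard alpha.
exists (m + 5 + m) => p.
have -> : expgz x p = alpha^-1 * (expgz x p ^ alpha^-1) * alpha.
  by rewrite -mulgA -conjgE conjgKV.
apply: (near_mul (near_mul (near_inv nm) _) nm).
apply: (near_normalizer Mspherical Scard S3 X0 XT); rewrite -/H.
have := PA_act_fixz p xQ; rewrite QE /PA_act -!conj_setM => E.
have := congr1 (fun K => conj_set K alpha^-1) E; rewrite -!conj_setM mulgV conj_set1.
by rewrite /PA_act !conjgE invgK !invgM invgK.
Qed.

Lemma normalizes_elliptic x : normalizes_parabolic x -> AL_elliptic x.
Proof.
move=> [Q [pQ Q1 QT xQ]]; apply: AL_ellipticP => //.
exact: near_normalizes xQ.
Qed.

Lemma simplex_elliptic x : preserves_simplex x -> AL_elliptic x.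
Proof.
move=> [F [[Ffin [Q0 FQ0] Fvert _] xF]]; apply: AL_ellipticP => //.
have Fiter n : F (iter n (PA_act x) Q0).
  by elim: n => // n IHn; rewrite -xF; exists (iter n (PA_act x) Q0).
have [l lE] := (finite_seqP F).1 Ffin.
(* Pigeonhole on the iterates of [Q0] inside the finite simplex: two of them coincide, so
   [x ^+ (j - i)] normalizes [Q0]. *)
have /(uniqPn Q0)[i [j [ij]]] : ~~ uniq (mkseq (fun n => iter n (PA_act x) Q0) (size l).+1).
  apply/negP => /(@uniq_leq_size _ _ l); rewrite size_mkseq ltnn => Habs.
  suff: false by []; apply: Habs => _ /mapP[n _ ->].
  by have := Fiter n; rewrite lE.
rewrite size_mkseq => jl; rewrite !nth_mkseq //; last exact: ltn_trans jl.
rewrite -(subnKC (ltnW ij)) iterD -!PA_actX => E.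
have {}E : PA_act (x ^+ (j - i)) Q0 = Q0.
  by rewrite -[RHS](PA_actK (x ^+ i)) E PA_actK.
have [[pQ _] Q1 QT] := Fvert _ FQ0.
apply: (@near_pow _ _ Mspherical Scard x (j - i)); first by rewrite subn_gt0.
exact: near_normalizes E.
Qed.

Lemma expgz_gen_eq1 s p : expgz (gen s) p = 1 -> p = 0%R.
Proof.
have H n : gen s ^+ n.+1 <> 1.
  by rewrite -pos_nseq -pos_nil => /(pos_size Mspherical).
case: p => [[|n]|n] //=; first by move/H.
by move=> /(congr1 (fun z => z^-1)); rewrite invgK invg1 => /H.
Qed.

Lemma std_parabolic1 s : std_parabolic M [set s]%SET = range (expgz (gen s)).
Proof.
have PE : (fun r => r \in [set s]%SET) = pred1 s by apply/funext => r; rewrite inE.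
apply/seteqP; split=> a.
  move/(std_parabolicE Mspherical); rewrite PE => -[n [_ [/posin_pow[m ->] ->]]].
  by rewrite D_pred1 //; exists (- n%:Z + m%:Z)%R => //; rewrite expgzD expgzN.
move=> [p _ <-] H [[[H1 HM] HV] Hg].
have Hs : H (gen s) by apply: Hg; exists s; rewrite //= inE.
have HX n : H (gen s ^+ n) by elim: n => // n IHn; rewrite expgS; apply: HM.
by case: p => n; [apply: HX|apply: HV; apply: HX].
Qed.

Lemma parabolic_subgroup (Q : set A) : parabolic Q -> is_subgroup Q.
Proof.
move=> [X [alpha ->]]; split; first split.
- by exists 1; rewrite ?conj1g // => H [[[]]].
- move=> _ _ [a Ha <-] [b Hb <-]; exists (a * b); rewrite ?conjMg // => H HH.
  by have [[[_ HM] _] _] := HH; apply: HM; [apply: Ha|apply: Hb].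
- move=> _ [a Ha <-]; exists a^-1; rewrite ?conjVg // => H HH.
  by have [[_ HV] _] := HH; apply: HV; apply: Ha.
Qed.

Lemma subgroup_expgz (Q : set A) a p : is_subgroup Q -> Q a -> Q (expgz a p).
Proof.
move=> [[Q1 QM] QV] Qa.
have QX n : Q (a ^+ n) by elim: n => // n IHn; rewrite expgS; apply: QM.
by case: p => n; [apply: QX|apply: QV; apply: QX].
Qed.

Lemma nontrivial_subgroup (Q : set A) : is_subgroup Q -> Q <> [set 1] -> exists2 a, Q a & a <> 1.
Proof.
move=> [[Q1 _] _] nQ; apply: contrapT => H; apply: nQ; apply/seteqP; split=> [a Qa|_ ->//].
by apply: contrapT => a1; apply: H; exists a.
Qed.

(** The subgroup is infinite cyclic, so nontrivial subgroups containing [s^p] and [s^q] share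
    [s^(pq)], which excludes a direct decomposition. It is proper since another generator has
    different support. *)
Lemma PA_vertex_gen s : PA_vertex (std_parabolic M [set s]%SET).
Proof.
have par : parabolic (std_parabolic M [set s]%SET).
  by exists [set s]%SET, 1; rewrite conj_set1.
rewrite std_parabolic1 in par *; split; first split=> //.
- case=> Q1 [Q2 [pQ1 pQ2 nQ1 nQ2 [QE _ QI]]].
  have sQ1 := parabolic_subgroup pQ1; have sQ2 := parabolic_subgroup pQ2.
  have [[Q11 _] _] := sQ1; have [[Q21 _] _] := sQ2.
  have [a Qa a1] := nontrivial_subgroup sQ1 nQ1.
  have [b Qb b1] := nontrivial_subgroup sQ2 nQ2.
  have [p _ pE] : range (expgz (gen s)) a by rewrite QE; exists a, 1; rewrite mulg1.
  have [q _ qE] : range (expgz (gen s)) b by rewrite QE; exists 1, b; rewrite mul1g.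
  have : (Q1 `&` Q2) (expgz (gen s) (p * q)%R).
    split; first by rewrite expgzM pE; apply: subgroup_expgz.
    by rewrite mulrC expgzM qE; apply: subgroup_expgz.
  rewrite QI => /expgz_gen_eq1/eqP; rewrite mulf_eq0 => /orP[]/eqP E.
    by apply: a1; rewrite -pE E.
  by apply: b1; rewrite -qE E.
- move=> E; apply: (gen_neq1 Mspherical (s := s)).
  have : range (expgz (gen s)) (gen s) by exists 1%R.
  by rewrite E.
- move=> E; have [t ts] := other_gen Scard s.
  have : range (expgz (gen s)) (gen t) by rewrite E.
  rewrite -std_parabolic1 => /(std_parabolicE Mspherical).
  have -> : (fun r => r \in [set s]%SET) = pred1 s by apply/funext => r; rewrite inE.
  move=> [n [_ [/posin_pow[m ->] E2]]].
  have : gen s ^+ n * gen t = gen s ^+ m by rewrite E2 D_pred1 // mulVKg.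
  rewrite -!pos_nseq -(mulg1 (gen t)) -pos_nil -pos_cons -pos_cat.
  move/(pos_all Mspherical (pred1 s)); rewrite all_cat /= (negbTE ts) andbF.
  by rewrite all_nseq /= eqxx orbT.
Qed.

Lemma periodic_elliptic x : periodic x -> AL_elliptic x.
Proof.
move=> [p [p0 xp]]; apply: AL_ellipticP => //.
have [s _] := gen_exists Scard; have Vs := PA_vertex_gen s.
have [[pQ _] Q1 QT] := Vs.
have [n nxp] := near_normalizes pQ Q1 QT (xp _ Vs).
(* For a negative exponent the bound is transferred by negating the outer exponent [q]. *)
case: p p0 {xp} nxp => [[//|k]|k] _ nxp.
  by apply: (@near_pow _ _ Mspherical Scard x k.+1) => //; exists n.
apply: (@near_pow _ _ Mspherical Scard x k.+1) => //; exists n => q.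
by have := nxp (-1 * q)%R; rewrite expgzM /= expg1 invgK.
Qed.
End Main.

Theorem theorem2 (S : finType) (M : cox_matrix S)
  (Mspherical : spherical M) (Mirreducible : irreducible M)
  (Mrank : 2 < #|S|) (x : artin M)
  (hx : periodic x \/ preserves_simplex x \/ normalizes_parabolic x) :
  AL_elliptic x.
Proof.
case: hx => [|[]].
- exact: periodic_elliptic.
- exact: simplex_elliptic.
- exact: normalizes_elliptic.
Qed.
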